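(* Let $0\le r<s<t$, $\theta=\frac{s-r}{t-r}$, and $0<\tilde\theta<\theta$. Then the following continuous embeddings hold: $$(B^r,B^t)_{\theta,1}\hookrightarrow B^s\hookrightarrow (B^r,B^t)_{\tilde\theta,1}.$$
   Context: Functions are complex valued on $\mathbb R^n$; $\hat f(\xi)=\int_{\mathbb R^n}e^{-ix\cdot\xi}f(x)\,dx$ is the Fourier transform (extended to tempered distributions); $\langle\xi\rangle=\sqrt{1+|\xi|^2}$; $C_b^0$ is the space of bounded continuous functions on $\mathbb R^n$. For $s\ge0$, $B^s=\{f\in C_b^0:\ \langle\xi\rangle^s\hat f\in L^1(\mathbb R^n)\}$ with norm $\|f\|_{B^s}=\|\langle\xi\rangle^s\hat f\|_{L^1}$ (a Banach space). For $0<\theta<1$ the real interpolation space is $$(B^r,B^t)_{\theta,1}=\left\{f\in B^r+B^t:\ \rho^{-\theta}K(\rho,f)\in L^1\left((0,\infty),d\rho/\rho\right)\right\},$$ where $K(\rho,f)=\inf\{\|g\|_{B^r}+\rho\|h\|_{B^t}:\ g\in B^r,\ h\in B^t,\ g+h=f\}$, with norm $\|f\|_{(B^r,B^t)_{\theta,1}}=\int_0^\infty\rho^{-\theta}K(\rho,f)\,\frac{d\rho}{\rho}$. $Y\hookrightarrow X$ means that $Y\subset X$ with continuous inclusion. *)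

(* Defs.v *)
From HB Require Import structures.
From mathcomp Require Import all_boot all_order all_algebra.
From mathcomp Require Import all_classical all_reals all_analysis.
From mathcomp Require Import complex.

Set Implicit Arguments.
Unset Strict Implicit.
Unset Printing Implicit Defensive.

Import Order.TTheory GRing.Theory Num.Theory.
Import numFieldNormedType.Exports.

Local Open Scope classical_set_scope.
Local Open Scope ring_scope.

(* 'rV[R]_n carries the product of the Borel sigma-algebras of its coordinates,
   and [lebesgue_rV n] is Lebesgue measure on it, the image of
   [lebesgue_measure \x lebesgue_rV n'] when n = n'.+1. *)

Definition rV_display : measure_display -> measure_display.
Proof. exact. Qed.

Section measurable_rV.
Context {d} {T : sigmaRingType d} (n : nat).

Let coors : 'I_n -> 'rV[T]_n -> T := fun i x => x ord0 i.

Let rV_set0 : g_sigma_preimage coors set0.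
Proof. exact: sigma_algebra0. Qed.

Let rV_setC A : g_sigma_preimage coors A -> g_sigma_preimage coors (~` A).
Proof. exact: sigma_algebraC. Qed.

Let rV_bigcup (F : _^nat) : (forall i, g_sigma_preimage coors (F i)) ->
  g_sigma_preimage coors (\bigcup_i (F i)).
Proof. exact: sigma_algebra_bigcup. Qed.

HB.instance Definition _ := @isMeasurable.Build (rV_display d)
  'rV[T]_n (g_sigma_preimage coors) rV_set0 rV_setC rV_bigcup.

End measurable_rV.

Lemma measurable_fun_rVP d1 d2 (T1 : measurableType d1) (T2 : measurableType d2)
    n (f : T1 -> 'rV[T2]_n) :
  measurable_fun [set: T1] f <->
  forall i, measurable_fun [set: T1] (fun x => f x ord0 i).
Proof.
have gen : (g_sigma_preimage (fun i x => f x ord0 i) `<=` measurable) <->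
    measurable_fun [set: T1] f.
  rewrite (g_sigma_preimage_comp (fun i (v : 'rV[T2]_n) => v ord0 i) f).
  split=> [prefS _ A mA|mf A [/= C preC <-]]; last exact: mf.
  by apply: prefS; exists A.
apply: (iff_trans (iff_sym gen)); split=> [sub i _ A mA|mf].
- apply: sub; apply: sub_sigma_algebra; rewrite -bigcup_seq/=.
  by exists i => /=; [rewrite mem_index_enum|exists A].
- apply: smallest_sub; first exact: sigma_algebra_measurable.
  rewrite -bigcup_seq/=; apply: bigcup_sub => i _ A [B mB <-].
  exact: mf.
Qed.

Lemma measurable_rV_coord d (T : measurableType d) n (i : 'I_n) :
  measurable_fun [set: 'rV[T]_n] (fun v : 'rV[T]_n => v ord0 i).
Proof. by move: i; apply/measurable_fun_rVP; exact: measurable_id. Qed.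

Section lebesgue_rV.
Context {R : realType}.
Local Open Scope ereal_scope.

Definition rV_cons n (p : measurableTypeR R * 'rV[R]_n) : 'rV[R]_n.+1 :=
  row_mx (const_mx p.1 : 'rV[R]_1) p.2.

Definition rV_uncons n (v : 'rV[R]_n.+1) : measurableTypeR R * 'rV[R]_n :=
  (v ord0 ord0, \row_i v ord0 (lift ord0 i)).

Lemma rV_consK n : cancel (@rV_cons n) (@rV_uncons n).
Proof.
move=> [x v]; rewrite /rV_uncons /rV_cons; congr pair => /=.
  by rewrite mxE; case: splitP => // j _; rewrite mxE.
apply/rowP => i; rewrite !mxE; case: splitP => [j|j].
  by rewrite ord1.
by rewrite lift0 /= add1n => -[] /ord_inj ->.
Qed.

Lemma measurable_rV_cons n : measurable_fun setT (@rV_cons n).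
Proof.
apply/measurable_fun_rVP => i; rewrite /rV_cons.
under eq_fun do rewrite mxE.
case: (@splitP 1 n i) => j _.
  by under eq_fun do rewrite mxE; exact: measurable_fst.
exact: (measurableT_comp (measurable_rV_coord j) measurable_snd).
Qed.

Lemma measurable_rV_uncons n : measurable_fun setT (@rV_uncons n).
Proof.
apply/measurable_fun_pair; first exact: measurable_rV_coord.
apply/measurable_fun_rVP => i; under eq_fun do rewrite mxE.
exact: measurable_rV_coord.
Qed.

Section cons.
Context n (mu : {sigma_finite_measure set 'rV[R]_n -> \bar R}).

Definition lebesgue_rV_cons : set 'rV[R]_n.+1 -> \bar R :=
  pushforward (lebesgue_measure \x mu) (@rV_cons n).

Let lebesgue_rV_cons0 : lebesgue_rV_cons set0 = 0.
Proof. by rewrite /lebesgue_rV_cons /pushforward preimage_set0 measure0. Qed.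

Let lebesgue_rV_cons_ge0 A : 0 <= lebesgue_rV_cons A.
Proof. exact: (measure_ge0 (lebesgue_measure \x mu)). Qed.

Let lebesgue_rV_cons_sigma_additive : semi_sigma_additive lebesgue_rV_cons.
Proof.
move=> F mF tF mUF; rewrite /lebesgue_rV_cons /pushforward preimage_bigcup.
have mcons A : measurable A -> measurable (@rV_cons n @^-1` A).
  by move=> mA; rewrite -[X in measurable X]setTI; exact: measurable_rV_cons.
apply: measure_semi_sigma_additive => [k||]; first exact: mcons.
- apply/trivIsetP => i j _ _ ij; rewrite -preimage_setI.
  by move/trivIsetP : tF => /(_ _ _ _ _ ij) ->//; rewrite preimage_set0.
- by rewrite -preimage_bigcup; exact: mcons.
Qed.

HB.instance Definition _ := isMeasure.Build _ _ _ lebesgue_rV_cons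
  lebesgue_rV_cons0 lebesgue_rV_cons_ge0 lebesgue_rV_cons_sigma_additive.

Let lebesgue_rV_cons_sigma_finite : sigma_finite setT lebesgue_rV_cons.
Proof.
have /sigma_finiteP[F [FT ndF Foo]] := sigma_finiteT (@lebesgue_measure R).
have /sigma_finiteP[G [GT ndG Goo]] := sigma_finiteT mu.
exists (fun k => @rV_uncons n @^-1` (F k `*` G k)).
  rewrite -preimage_bigcup; apply/esym; rewrite -subTset => v _.
  have [j _ Fj] : (\bigcup_i F i) (rV_uncons v).1 by rewrite -FT.
  have [k _ Gk] : (\bigcup_i G i) (rV_uncons v).2 by rewrite -GT.
  exists (maxn j k) => //; split.
  - by move: Fj; exact/subsetPset/ndF/leq_maxl.
  - by move: Gk; exact/subsetPset/ndG/leq_maxr.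
move=> k; have [mF Fk] := Foo k; have [mG Gk] := Goo k; split.
  by rewrite -[X in measurable X]setTI; apply: measurable_rV_uncons => //;
    exact: measurableX.
rewrite /lebesgue_rV_cons /pushforward -comp_preimage.
rewrite (_ : _ \o _ = id); last by apply/funext => x /=; rewrite rV_consK.
rewrite preimage_id product_measure1E//.
by rewrite lte_mul_pinfty// ge0_fin_numE.
Qed.

HB.instance Definition _ := Measure_isSigmaFinite.Build _ _ _
  lebesgue_rV_cons lebesgue_rV_cons_sigma_finite.

End cons.

Fixpoint lebesgue_rV n : {sigma_finite_measure set 'rV[R]_n -> \bar R} :=
  match n with
  | 0 => dirac (0 : 'rV[R]_0)%R
  | m.+1 => lebesgue_rV_cons (lebesgue_rV m)
  end.

End lebesgue_rV.

Section fourier.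
Context {R : realType} (n : nat).
Local Notation V := 'rV[R]_n.
Local Notation leb := (@lebesgue_rV R n).
Local Notation Re := complex.Re.
Local Notation Im := complex.Im.
Local Notation normc := ComplexField.Normc.normc.
Implicit Types (f F phi : V -> R[i]) (g : V -> R) (x xi : V) (s : R).

Definition dotv x xi : R := \sum_i x ord0 i * xi ord0 i.

Definition jbracket xi : R := Num.sqrt (1 + dotv xi xi).

Definition expi (a : R) : R[i] := (cos a +i* sin a)%C.

Definition Cintegrable F :=
  leb.-integrable setT (fun x => (Re (F x))%:E) /\
  leb.-integrable setT (fun x => (Im (F x))%:E).

Definition Cintegral F : R[i] :=
  ((\int[leb]_x Re (F x)) +i* (\int[leb]_x Im (F x)))%C.

Definition L1norm F : \bar R := (\int[leb]_x (normc (F x))%:E)%E.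

Definition partial (i : 'I_n) g : V -> R := 'D_(delta_mx ord0 i) g.

Definition partials (alpha : seq 'I_n) g : V -> R := foldr partial g alpha.

Definition schwartzR g :=
  (forall alpha x, differentiable (partials alpha g) x) /\
  (forall alpha (k : nat), exists M : R,
     forall x, jbracket x ^+ k * `|partials alpha g x| <= M).

Definition schwartz phi :=
  schwartzR (fun x => Re (phi x)) /\
  schwartzR (fun x => Im (phi x)).

Definition fourier phi : V -> R[i] :=
  fun xi => Cintegral (fun x => expi (- dotv x xi) * phi x).

(* The Fourier transform of the tempered distribution phi |-> \int f phi (f
   bounded and continuous) is phi |-> \int f (fourier phi).  Only integrable
   representatives F are considered: for s >= 0, integrability of
   <xi>^s F implies that of F. *)
Definition is_fourier f F :=
  Cintegrable F /\
  (forall phi, schwartz phi ->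
    Cintegral (fun x => f x * fourier phi x) =
    Cintegral (fun xi => F xi * phi xi)).

(* Defined up to a null set; 0 if the Fourier transform of f is not an
   integrable function. *)
Definition fhat f : V -> R[i] := xget (fun=> 0) [set F | is_fourier f F].

Definition Cb0 f :=
  continuous (f : V -> (R[i])^o) /\
  exists M : R, forall x, normc (f x) <= M.

Definition weighted s F : V -> R[i] :=
  fun xi => ((jbracket xi `^ s)%:C)%C * F xi.

End fourier.

Section interpolation.
Context {R : realType}.
Local Open Scope ereal_scope.

(* A subset of E together with a gauge that is only meaningful on that subset;
   the spaces below are linear subspaces normed by their gauge. *)
Record nspace (E : zmodType) := NSpace {
  nset : set E ;
  nnorm : E -> \bar R }.

Definition embeds (E : zmodType) (Y X : nspace E) :=
  nset Y `<=` nset X /\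
  forall f, nset Y f -> forall e : R, (0 < e)%R -> exists2 d : R, (0 < d)%R &
    forall g, nset Y g ->
      nnorm Y (g - f)%R < d%:E -> nnorm X (g - f)%R < e%:E.

Variables (E : zmodType) (X0 X1 : nspace E).

Definition Kfun (rho : R) (f : E) : \bar R :=
  ereal_inf [set k | exists g h, [/\ nset X0 g, nset X1 h, (g + h)%R = f
                               & k = nnorm X0 g + rho%:E * nnorm X1 h]].

Definition Kweight (theta : R) (f : E) (rho : R) : \bar R :=
  (rho `^ (- theta))%:E * Kfun rho f * (rho^-1)%:E.

Definition interp (theta : R) : nspace E :=
  {| nset := [set f | (exists g h, [/\ nset X0 g, nset X1 h & (g + h)%R = f]) /\
       (@lebesgue_measure R).-integrable `]0%R, +oo[ (Kweight theta f)] ;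
     nnorm := fun f => \int[lebesgue_measure]_(rho in `]0%R, +oo[)
       Kweight theta f rho |}.

End interpolation.

Definition Bspace {R : realType} (n : nat) (s : R) : nspace ('rV[R]_n -> R[i]) :=
  {| nset := [set f | [/\ Cb0 f, exists F, is_fourier f F
                          & Cintegrable (weighted s (fhat f))]] ;
     nnorm := fun f => L1norm (weighted s (fhat f)) |}.

(* Main.v *)
(* Only two facts about the Fourier transform are needed. It is injective: the
   Schwartz functions [expR (- q)], [q] a polynomial, approximate the indicators of
   open boxes, so they separate integrable functions. And it inverts on Schwartz
   functions up to a nonzero constant, which is never computed; hence every
   integrable [F] is the transform of a multiple of its inverse transform.
   A splitting of [f] in [B^r + B^t] is then a splitting of its transform, and
   [K rho f] is comparable to the integral of [min (<xi>^r) (rho <xi>^t)] against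
   the modulus of that transform: the upper bound comes from a sharp frequency
   cutoff, and the lower bound is integrated in [rho] with Tonelli. *)

From HB Require Import structures.
Require Import Defs.
From mathcomp Require Import all_boot all_order all_algebra.
From mathcomp Require Import all_classical all_reals all_analysis.
From mathcomp Require Import measurable_realfun complex ring lra.

Import Order.TTheory GRing.Theory Num.Theory.
Import numFieldNormedType.Exports.
Set Implicit Arguments.
Unset Strict Implicit.
Unset Printing Implicit Defensive.
Local Open Scope classical_set_scope.
Local Open Scope ring_scope.

(** [fhat] picks one representative modulo null sets, characterised by pairings with Schwartz
    functions; transforms therefore add only almost everywhere, and norms are computed from explicit
    transforms through uniqueness. Schwartz functions and their transforms are controlled by one
    integrable product weight, [cauchyw]; for transforms the bound comes from integration by parts,
    one coordinate at a time. In the cutoff only the low-frequency part is built as an inverse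
    transform. The high-frequency part is its difference with [f], hence bounded and continuous
    without an inversion formula for [f]. The weights [<xi>^r] and [rho <xi>^t] cross at
    [rho = <xi>^(r - t)], and integrating [rho^(- theta - 1) <xi>^r] over a window of ratio 2 at
    that scale returns a multiple of [<xi>^s]. Conversely the cutoff bounds [K rho f] by
    [2 rho^theta] times the norm of [f], which is too weak for large [rho]; there the splitting
    [f + 0] gives a bound free of [rho]. The weighted integral then converges at 0 because
    [theta' < theta], and at infinity because [0 < theta']. *)

Local Notation Re := complex.Re.
Local Notation Im := complex.Im.
Local Notation normc := ComplexField.Normc.normc.

(** * Lebesgue measure on R^n: slicing, affine substitutions and an integrable weight *)

Section lebesgue_rV_integral.
Context {R : realType}.
Local Open Scope ereal_scope.
Local Notation leb1 := (@lebesgue_measure R).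

Lemma ge0_integral_rV_cons n (f : 'rV[R]_n.+1 -> \bar R) :
  measurable_fun setT f -> (forall x, 0 <= f x) ->
  \int[lebesgue_rV n.+1]_x f x =
  \int[leb1]_x \int[lebesgue_rV n]_v f (rV_cons (x, v)).
Proof.
move=> mf f0.
transitivity (\int[leb1 \x lebesgue_rV n]_p f (rV_cons p)).
  rewrite -[RHS](@ge0_integral_pushforward _ _ _ _ _ _ (@measurable_rV_cons R n) (leb1 \x lebesgue_rV n) setT f)//.
rewrite fubini_tonelli1//.
exact: (measurableT_comp mf (@measurable_rV_cons R n)).
Qed.

(** The image of Lebesgue measure under [a + e * x], scaled by [e], gives every half-open interval
    its length, so it is Lebesgue measure by uniqueness. *)
Lemma ge0_integral_affine1 (a e : R) (f : measurableTypeR R -> \bar R) : (0 < e)%R ->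
  measurable_fun setT f -> (forall x, 0 <= f x) ->
  e%:E * \int[leb1]_x f (a + e * x)%R = \int[leb1]_x f x.
Proof.
move=> e0 mf f0.
have maff : measurable_fun setT (fun x : measurableTypeR R => (a + e * x)%R : measurableTypeR R).
  by apply: measurable_funD => //; apply: measurable_funM.
pose ee : {nonneg R} := NngNum (ltW e0).
rewrite -[X in _ * X](@ge0_integral_pushforward _ _ _ _ _ _ maff leb1 setT f)//.
rewrite -(@ge0_integral_mscale _ _ _ _ setT measurableT ee f)//.
apply: eq_measure_integral => A mA _.
apply/esym/lebesgue_measure_unique => // _ [[x y] _ <-] /=.
rewrite /mscale/= /pushforward lebesgue_measure_itv/=.
rewrite (_ : _ @^-1` _ = `](x - a) / e, (y - a) / e]%classic)%R; last first.
  apply/seteqP; split => z /=; rewrite !in_itv/= ltr_pdivrMr// ler_pdivlMr//; lra.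
rewrite lebesgue_measure_itv/= !lte_fin ltr_pM2r ?invr_gt0// ltrD2r.
case: ifPn => _; last by rewrite mule0.
rewrite -!EFinD -EFinM; congr EFin; field; lra.
Qed.

Lemma rV_cons_ord0 n (p : measurableTypeR R * 'rV[R]_n) :
  rV_cons p ord0 ord0 = p.1.
Proof. by have := rV_consK p; rewrite /rV_uncons => /(congr1 fst). Qed.

Lemma rV_cons_lift n (p : measurableTypeR R * 'rV[R]_n) i :
  rV_cons p ord0 (lift ord0 i) = p.2 ord0 i.
Proof.
by have := rV_consK p; rewrite /rV_uncons => /(congr1 snd)/rowP/(_ i); rewrite mxE.
Qed.

Lemma measurable_affine_rV n (a : 'rV[R]_n) (e : R) :
  measurable_fun setT (fun x : 'rV[R]_n => (a + e *: x : 'rV[R]_n)%R).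
Proof.
apply/measurable_fun_rVP => i; under eq_fun do rewrite !mxE.
apply: measurable_funD; first exact: measurable_cst.
apply: measurable_funM; first exact: measurable_cst.
exact: measurable_rV_coord.
Qed.

Lemma ge0_integral_affine n (a : 'rV[R]_n) (e : R) (f : 'rV[R]_n -> \bar R) :
  (0 < e)%R -> measurable_fun setT f -> (forall x, 0 <= f x) ->
  (e ^+ n)%:E * \int[lebesgue_rV n]_x f (a + e *: x)%R =
  \int[lebesgue_rV n]_x f x.
Proof.
move=> e0; elim: n a f => [a f mf f0|n IH a f mf f0].
  by rewrite mul1e; apply: eq_integral => x _; congr f; rewrite !thinmx0.
have mfa := measurableT_comp mf (measurable_affine_rV a e).
have mfc := measurableT_comp mf (@measurable_rV_cons R n).
rewrite !ge0_integral_rV_cons//.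
rewrite -[RHS](@ge0_integral_affine1 (a ord0 ord0) e); last 3 first.
- exact: e0.
- exact: (measurable_fun_fubini_tonelli_F _ mfc (fun=> f0 _)).
- by move=> x; apply: integral_ge0.
rewrite exprS EFinM -muleA -ge0_integralZl//=; last 3 first.
- exact: (measurable_fun_fubini_tonelli_F _ (measurableT_comp mfa (@measurable_rV_cons R n)) (fun=> f0 _)).
- by move=> x _; apply: integral_ge0.
- by rewrite lee_fin exprn_ge0// ltW.
congr (_ * _); apply: eq_integral => x _.
rewrite -(IH (rV_uncons a).2 (fun v => f (rV_cons (a ord0 ord0 + e * x, v)%R)))//; last first.
  exact: (measurableT_comp mfc (measurable_pair1 _)).
congr (_ * _); apply: eq_integral => v _; congr f.
apply/rowP => i; case: (unliftP ord0 i) => [j|] ->.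
  by rewrite rV_cons_lift 2!mxE rV_cons_lift !mxE.
by rewrite rV_cons_ord0 2!mxE rV_cons_ord0.
Qed.

Lemma integral_dirac0 (f : 'rV[R]_0 -> \bar R) :
  measurable_fun setT f -> \int[lebesgue_rV 0]_x f x = f 0%R.
Proof. by move=> mf; rewrite integral_dirac//= diracT mul1e. Qed.

(** Ensures that a strictly positive function, the Gaussian, has nonzero integral, in dimension 0 as
    well. *)
Lemma lebesgue_rVT_neq0 n : lebesgue_rV n [set: 'rV[R]_n] != 0.
Proof.
elim: n => [|n IH]; first by rewrite /= diracT eqe oner_eq0.
rewrite [X in X != _](_ : _ = lebesgue_measure (setT : set (measurableTypeR R)) * lebesgue_rV n [set: 'rV[R]_n]).
  rewrite mule_neq0// gt_eqF//; apply: (@lt_le_trans _ _ (leb1 `[0%R, 1%R]%classic)).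
    by rewrite lebesgue_measure_itv/= lte_fin ltr01 oppr0 adde0 lte_fin.
  by apply: le_measure; rewrite ?inE.
rewrite -product_measure1E//.
by rewrite setXTT.
Qed.

(** A product, so that its integrability reduces to the arctangent integral in each coordinate, and
    so that each factor can be gained by one differential operator on the other side of the Fourier
    transform. *)
Definition cauchyw n (x : 'rV[R]_n) : R := (\prod_i (1 + x ord0 i ^+ 2)^-1)%R.

Lemma integral_oneDsqrV_lty : \int[leb1]_x ((1 + x ^+ 2)^-1)%:E < +oo.
Proof.
rewrite (@ge0_symfun_integralT R (fun x => (oneDsqr x)^-1)%R).
- rewrite -set_itvcy integral0y_oneDsqr -EFinM ltry //.
- by move=> x; rewrite invr_ge0 addr_ge0// sqr_ge0.
- exact: continuous_oneDsqrV.
- by move=> x /=; rewrite /oneDsqr sqrrN.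
Qed.

Lemma measurable_cauchyw n : measurable_fun setT (@cauchyw n).
Proof.
rewrite /cauchyw; apply: measurable_prod => i _ /=.
apply: (@measurableT_comp _ _ _ _ _ _ (fun y : R => (1 + y ^+ 2)^-1)%R).
  by apply: continuous_measurable_fun; exact: continuous_oneDsqrV.
exact: measurable_rV_coord.
Qed.

Lemma cauchyw_gt0 n (x : 'rV[R]_n) : (0 < cauchyw x)%R.
Proof.
by apply: prodr_gt0 => i _; rewrite invr_gt0 ltr_wpDr// sqr_ge0.
Qed.

Lemma integral_cauchyw_lty n : \int[lebesgue_rV n]_x (cauchyw x)%:E < +oo.
Proof.
elim: n => [|n IH].
  by rewrite integral_dirac0 ?ltry//; apply/measurable_EFinP; exact: measurable_cauchyw.
rewrite ge0_integral_rV_cons; last 2 first.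
- by apply/measurable_EFinP; exact: measurable_cauchyw.
- by move=> x; rewrite lee_fin ltW// cauchyw_gt0.
have cE x v : cauchyw (rV_cons (x, v) : 'rV[R]_n.+1) = ((1 + x ^+ 2)^-1 * cauchyw v)%R.
  rewrite /cauchyw big_ord_recl rV_cons_ord0; congr (_ * _)%R.
  by apply: eq_bigr => i _; rewrite rV_cons_lift.
under eq_integral => x _.
  under eq_integral do rewrite cE EFinM.
  rewrite ge0_integralZl//; last 3 first.
  - by apply/measurable_EFinP; exact: measurable_cauchyw.
  - by move=> v _; rewrite lee_fin ltW// cauchyw_gt0.
  - by rewrite lee_fin invr_ge0 addr_ge0// sqr_ge0.
  over.
rewrite ge0_integralZr//; last 3 first.
- apply/measurable_EFinP; apply: continuous_measurable_fun; exact: continuous_oneDsqrV.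
- by move=> x _; rewrite lee_fin invr_ge0 addr_ge0// sqr_ge0.
- by apply: integral_ge0 => v _; rewrite lee_fin ltW// cauchyw_gt0.
have i0 : 0 <= \int[leb1]_x ((1 + x ^+ 2)^-1)%:E.
  by apply: integral_ge0 => v _; rewrite lee_fin invr_ge0 addr_ge0// sqr_ge0.
by rewrite lte_mul_pinfty// ge0_fin_numE// integral_oneDsqrV_lty.
Qed.

Lemma integrable_cauchyw n : (lebesgue_rV n).-integrable setT (EFin \o @cauchyw n).
Proof.
apply/integrableP; split; first by apply/measurable_EFinP; exact: measurable_cauchyw.
under eq_integral => x _ do rewrite /= ger0_norm ?(ltW (cauchyw_gt0 _))//.
exact: integral_cauchyw_lty.
Qed.

End lebesgue_rV_integral.

(** * Measurability of open sets and of continuous functions *)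

Section measurable_rV_topology.
Context {R : realType} (n : nat).

Lemma measurable_rV_forall (A : 'I_n -> set R) : (forall i, measurable (A i)) ->
  measurable [set x : 'rV[R]_n | forall i, A i (x ord0 i)].
Proof.
move=> mA.
rewrite (_ : mkset _ = \bigcap_(i in [set: 'I_n]) ((fun x : 'rV[R]_n => x ord0 i) @^-1` A i)); last first.
  by apply/seteqP; split => x Ax i; [move=> _; exact: (Ax i)|exact: (Ax i I)].
apply: fin_bigcap_measurable; first exact: finite_finset.
move=> i _; rewrite -[X in measurable X]setTI.
exact: measurable_rV_coord.
Qed.

(** The sigma-algebra comes from the coordinates and the topology from the sup norm. They meet
    because an open set is the union of the grid cells of mesh [k.+1%:R^-1] that it contains, and
    there are countably many such cells. *)
Lemma open_measurable_rV (U : set 'rV[R]_n) : open U -> measurable U.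
Proof.
move=> oU.
pose cell (p : 'rV[int]_n * nat) : set 'rV[R]_n :=
  [set x | forall i, `[(p.1 ord0 i)%:~R, (p.1 ord0 i)%:~R + 1[%classic (p.2.+1%:R * x ord0 i)].
have mcell p : measurable (cell p).
  apply: (@measurable_rV_forall (fun i => ( *%R p.2.+1%:R) @^-1`
    `[(p.1 ord0 i)%:~R, (p.1 ord0 i)%:~R + 1[%classic)) => i.
  rewrite -[X in measurable X]setTI.
  by apply: mulrl_measurable => //; exact: measurable_itv.
(* [unpickle] enumerates the pairs of an integer corner and a mesh; codes of no pair, and cells not
   inside [U], contribute the empty set. *)
rewrite (_ : U = \bigcup_m (if unpickle m is Some p then
    if `[< cell p `<=` U >] then cell p else set0 else set0)); last first.
  apply/seteqP; split => [x Ux|x [m _]]; last first.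
    by case: (unpickle m) => // p; case: asboolP => // pU xp; exact: pU.
  have /nbhs_ballP[e /= e0 eU] : nbhs x U by exact: open_nbhs_nbhs.
  pose k := Num.truncn e^-1.
  have ke : k.+1%:R^-1 < e.
    by rewrite -[ltRHS]invrK ltf_pV2 ?posrE ?invr_gt0// truncnS_gt.
  pose p : 'rV[int]_n * nat := (\row_i Num.floor (k.+1%:R * x ord0 i), k).
  have px : cell p x.
    by move=> i; rewrite /p /= mxE in_itv/= ge_floor/=; have := floorD1_gt (k.+1%:R * x ord0 i); rewrite intrD.
  exists (pickle p) => //; rewrite pickleK ifT//; apply/asboolP => y py.
  apply: eU; split => // i j; rewrite ord1 /ball/=.
  have := px j; have := py j; rewrite /= !in_itv/= => /andP[y1 y2] /andP[x1 x2].
  apply: le_lt_trans ke.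
  rewrite -[leRHS]mul1r ler_pdivlMr// -[X in _ * X]gtr0_norm// -normrM mulrBl.
  rewrite ler_norml; lra.
apply: bigcupT_measurable => m; case: (unpickle m) => // p.
by case: ifP.
Qed.

Lemma continuous_measurable_rV (f : 'rV[R]_n -> R) :
  continuous f -> measurable_fun [set: 'rV[R]_n] f.
Proof.
move=> cf; apply: (measurability (@RGenOInfty.G R)).
  exact: RGenOInfty.measurableE.
move=> _ [_] [a ->] <-; rewrite setTI; apply: open_measurable_rV.
by move/continuousP : cf; apply; exact: interval_open.
Qed.

End measurable_rV_topology.

(** * Dominated convergence, Fubini and substitution for real-valued integrals *)

Section real_integrals.
Context d (T : measurableType d) {R : realType} (mu : {measure set T -> \bar R}).
Implicit Types f g : T -> R.

Lemma le_integrableR f g : measurable_fun setT f ->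
  (forall x, `|f x| <= g x) -> mu.-integrable setT (EFin \o g) ->
  mu.-integrable setT (EFin \o f).
Proof.
move=> mf fg; apply: le_integrable => //; first exact/measurable_EFinP.
by move=> x _ /=; rewrite lee_fin (le_trans (fg x))// ler_norm.
Qed.

Lemma integrableRZl f (k : R) : mu.-integrable setT (EFin \o f) ->
  mu.-integrable setT (EFin \o (fun x => k * f x)).
Proof.
by move=> fi; apply: eq_integrable (integrableZl measurableT k fi).
Qed.

Lemma integrableRZr f (k : R) : mu.-integrable setT (EFin \o f) ->
  mu.-integrable setT (EFin \o (fun x => f x * k)).
Proof.
by move/(integrableRZl k); apply: eq_integrable => // x _ /=; rewrite mulrC.
Qed.

Lemma cvg_Rintegral (f_ : nat -> T -> R) f g :
  (forall k, measurable_fun setT (f_ k)) ->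
  (forall x, f_ k x @[k --> \oo] --> f x) ->
  (forall k x, `|f_ k x| <= g x) -> mu.-integrable setT (EFin \o g) ->
  mu.-integrable setT (EFin \o f) /\
  (\int[mu]_x f_ k x @[k --> \oo] --> \int[mu]_x f x).
Proof.
move=> mf_ f_f fg ig.
have mf : measurable_fun setT f by apply: (measurable_fun_cvg mf_) => x _.
have [] := @dominated_convergence _ _ _ mu setT measurableT
  (fun k x => (f_ k x)%:E) (EFin \o f) (EFin \o g).
- by move=> k; exact/measurable_EFinP.
- exact/measurable_EFinP.
- by apply: aeW => x _; apply: cvg_EFin; [exact: nearW|exact: f_f].
- exact: ig.
- by apply: aeW => x k _; rewrite lee_fin.
move=> fi _ cv; split => //; apply: fine_cvg.
by rewrite fineK//; exact: integrable_fin_num.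
Qed.

End real_integrals.

Section real_fubini.
Context d1 d2 (T1 : measurableType d1) (T2 : measurableType d2) {R : realType}.
Variable m1 : {sigma_finite_measure set T1 -> \bar R}.
Variable m2 : {sigma_finite_measure set T2 -> \bar R}.

Lemma integrable_product (H : T1 * T2 -> R) (g : T1 -> R) (h : T2 -> R) :
  measurable_fun setT H -> (forall x y, `|H (x, y)| <= g x * h y) ->
  m1.-integrable setT (EFin \o g) -> m2.-integrable setT (EFin \o h) ->
  (m1 \x m2)%E.-integrable setT (EFin \o H).
Proof.
move=> mH Hgh ig ih.
have mg : measurable_fun setT g by apply/measurable_EFinP; case/integrableP: ig.
have mh : measurable_fun setT h by apply/measurable_EFinP; case/integrableP: ih.
(* Only the products [g x * h y] are known to be nonnegative; with absolute values the majorant has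
   nonnegative factors and Tonelli applies. *)
apply: (@le_integrableR _ _ _ _ _ (fun z : T1 * T2 => `|g z.1| * `|h z.2|)) => //.
  by move=> [x y]; rewrite (le_trans (Hgh _ _))// -normrM ler_norm.
have mgh : measurable_fun setT (EFin \o (fun z : T1 * T2 => `|g z.1| * `|h z.2|)).
  apply/measurable_EFinP; apply: measurable_funM; apply: measurableT_comp => //;
  by [exact: (measurableT_comp mg measurable_fst)|exact: (measurableT_comp mh measurable_snd)].
apply/(integrable12ltyP m1 m2 mgh) => /=.
under eq_integral => x _.
  under eq_integral do rewrite normrM !normr_id EFinM.
  rewrite ge0_integralZl//; last by do 2 apply: measurableT_comp => //.
  over.
rewrite ge0_integralZr//; last 2 first.
- by do 2 apply: measurableT_comp => //.
- exact: integral_ge0.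
case/integrableP: ig => _ ig; case/integrableP: ih => _ ih.
rewrite lte_mul_pinfty//.
- exact: integral_ge0.
- by rewrite ge0_fin_numE//; exact: integral_ge0.
Qed.

(** A bound by a product makes every section integrable, not just almost every one, so the inner
    real integrals are the extended ones and the identity transfers from [Fubini]. *)
Lemma Rintegral_Fubini (H : T1 -> T2 -> R) (g : T1 -> R) (h : T2 -> R) :
  measurable_fun setT (fun z : T1 * T2 => H z.1 z.2) ->
  (forall x y, `|H x y| <= g x * h y) ->
  m1.-integrable setT (EFin \o g) -> m2.-integrable setT (EFin \o h) ->
  \int[m1]_x (\int[m2]_y H x y) = \int[m2]_y (\int[m1]_x H x y).
Proof.
move=> mH Hgh ig ih.
have iH := integrable_product mH Hgh ig ih.
have H1 x : (\int[m2]_y H x y)%:E = (\int[m2]_y (H x y)%:E)%E.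
  rewrite fineK//; apply: integrable_fin_num => //.
  apply: (@le_integrableR _ _ _ _ _ (fun y => g x * h y)); last exact: integrableRZl.
    exact: (measurableT_comp mH (measurable_pair1 x)).
  by move=> y; exact: Hgh.
have H2 y : (\int[m1]_x H x y)%:E = (\int[m1]_x (H x y)%:E)%E.
  rewrite fineK//; apply: integrable_fin_num => //.
  apply: (@le_integrableR _ _ _ _ _ (fun x => g x * h y)); last exact: integrableRZr.
    exact: (measurableT_comp mH (measurable_pair2 y)).
  by move=> x; exact: Hgh.
rewrite /Rintegral; congr fine.
under eq_integral do rewrite H1.
under [RHS]eq_integral do rewrite H2.
exact: (Fubini iH).
Qed.

End real_fubini.

Section affine.
Context {R : realType} (n : nat) (a : 'rV[R]_n) (e : R).
Hypothesis e0 : 0 < e.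
Local Notation leb := (@lebesgue_rV R n).

Lemma integrable_affine (f : 'rV[R]_n -> R) : leb.-integrable setT (EFin \o f) ->
  leb.-integrable setT (fun x => (f (a + e *: x))%:E).
Proof.
case/integrableP => mf fi; have mf' := measurableT_comp mf (measurable_affine_rV a e).
apply/integrableP; split => //.
move: fi; rewrite -(@ge0_integral_affine _ _ a e (fun x => `|(f x)%:E|%E))//; last first.
  exact: measurableT_comp.
rewrite !ltey; apply: contra_neq => /= ->.
by rewrite gt0_muley// lte_fin exprn_gt0.
Qed.

Lemma Rintegral_affine (f : 'rV[R]_n -> R) : leb.-integrable setT (EFin \o f) ->
  e ^+ n * (\int[leb]_x f (a + e *: x)) = \int[leb]_x f x.
Proof.
move=> fi; have fai := integrable_affine fi.
have mf : measurable_fun setT (EFin \o f) by case/integrableP: fi.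
rewrite /Rintegral -[X in X * _]/(fine (e ^+ n)%:E) -fineM//; last first.
  exact: integrable_fin_num.
congr fine; rewrite integralE [RHS]integralE.
have fin1 : (\int[leb]_x ((fun x => (f (a + e *: x))%:E)^\+%E x) \is a fin_num)%E.
  by apply: integrable_fin_num => //; exact: integrable_funepos.
rewrite muleBr//; last by rewrite fin_num_adde_defr.
congr (_ - _)%E.
- rewrite -[RHS](@ge0_integral_affine _ _ a e ((EFin \o f)^\+%E))//; last first.
  exact: measurable_funepos.
  by congr (_ * _)%E; apply: eq_integral => x _; rewrite !funeposE.
- rewrite -[RHS](@ge0_integral_affine _ _ a e ((EFin \o f)^\-%E))//; last first.
  exact: measurable_funeneg.
  by congr (_ * _)%E; apply: eq_integral => x _; rewrite !funenegE.
Qed.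

End affine.

(** * Complex-valued functions: componentwise convergence, measurability, integration *)

Section complex_facts.
Context {R : realType}.
Implicit Types z w : R[i].

Lemma eq_ReIm z w : Re z = Re w -> Im z = Im w -> z = w.
Proof. by case: z w => [a b] [c d] /= -> ->. Qed.

Lemma ReCD z w : Re (z + w) = Re z + Re w. Proof. by case: z w => [a b] []. Qed.
Lemma ImCD z w : Im (z + w) = Im z + Im w. Proof. by case: z w => [a b] []. Qed.
Lemma ReCN z : Re (- z) = - Re z. Proof. by case: z. Qed.
Lemma ImCN z : Im (- z) = - Im z. Proof. by case: z. Qed.
Lemma ReCM z w : Re (z * w) = Re z * Re w - Im z * Im w.
Proof. by case: z w => [a b] []. Qed.
Lemma ImCM z w : Im (z * w) = Re z * Im w + Im z * Re w.
Proof. by case: z w => [a b] []. Qed.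

Lemma normc_ReIm z : normc z = Num.sqrt (Re z ^+ 2 + Im z ^+ 2).
Proof. by case: z. Qed.

Lemma normc_ge0 z : 0 <= normc z.
Proof. by rewrite normc_ReIm sqrtr_ge0. Qed.

Lemma normr_Re_le z : `|Re z| <= normc z.
Proof. by rewrite normc_ReIm -sqrtr_sqr ler_wsqrtr// lerDl sqr_ge0. Qed.

Lemma normr_Im_le z : `|Im z| <= normc z.
Proof. by rewrite normc_ReIm -sqrtr_sqr ler_wsqrtr// lerDr sqr_ge0. Qed.

Lemma normc_le_add z : normc z <= `|Re z| + `|Im z|.
Proof.
rewrite normc_ReIm -[leRHS]ger0_norm ?addr_ge0// -sqrtr_sqr ler_wsqrtr//.
rewrite -(real_normK (num_real (Re z))) -(real_normK (num_real (Im z))).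
have := mulr_ge0 (normr_ge0 (Re z)) (normr_ge0 (Im z)); lra.
Qed.

Lemma normcM z w : normc (z * w) = normc z * normc w.
Proof. exact: ComplexField.Normc.normcM. Qed.

Lemma le_normcD z w : normc (z + w) <= normc z + normc w.
Proof. by have := ler_normD z w; rewrite -[in X in X -> _]rmorphD/= lecR. Qed.

Lemma normc_realC (a : R) : normc (a%:C)%C = `|a|.
Proof. by rewrite normc_ReIm/= expr0n/= addr0 sqrtr_sqr. Qed.

Lemma normc_expi (a : R) : normc (expi a) = 1.
Proof. by rewrite normc_ReIm/= cos2Dsin2 sqrtr1. Qed.

Lemma expiD (a b : R) : expi (a + b) = expi a * expi b.
Proof. by apply: eq_ReIm; rewrite ?ReCM ?ImCM/= ?cosD ?sinD//; ring. Qed.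

(** Stated by components because [Cintegral] is; each limit theorem is then its real version used
    twice. *)
Definition ccvg (u_ : nat -> R[i]) (z : R[i]) :=
  (Re (u_ k) @[k --> \oo] --> Re z) /\ (Im (u_ k) @[k --> \oo] --> Im z).

Lemma ccvg_unique u_ z w : ccvg u_ z -> ccvg u_ w -> z = w.
Proof.
move=> [r1 i1] [r2 i2].
by apply: eq_ReIm; [exact: cvg_unique r1 r2|exact: cvg_unique i1 i2].
Qed.

Lemma ccvg_cst z : ccvg (fun=> z) z.
Proof. by split; exact: cvg_cst. Qed.

Lemma ccvgM (u_ v_ : nat -> R[i]) z w : ccvg u_ z -> ccvg v_ w ->
  ccvg (fun k => u_ k * v_ k) (z * w).
Proof.
move=> [r1 i1] [r2 i2]; split.
  by rewrite ReCM; under eq_fun do rewrite ReCM; apply: cvgB; exact: cvgM.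
by rewrite ImCM; under eq_fun do rewrite ImCM; apply: cvgD; exact: cvgM.
Qed.

Lemma ccvg_expi (a_ : nat -> R) (a : R) : a_ @ \oo --> a ->
  ccvg (fun k => expi (a_ k)) (expi a).
Proof.
move=> aa; split => /=.
  by apply: continuous_cvg => //; exact: continuous_cos.
by apply: continuous_cvg => //; exact: continuous_sin.
Qed.

End complex_facts.

Section Cmeasurable.
Context d (T : measurableType d) {R : realType}.
Implicit Types F G : T -> R[i].

Definition Cmeasurable F :=
  measurable_fun setT (fun x => Re (F x)) /\
  measurable_fun setT (fun x => Im (F x)).

Lemma Cmeasurable_cst (c : R[i]) : Cmeasurable (fun=> c).
Proof. by split; exact: measurable_cst. Qed.

Lemma CmeasurableD F G : Cmeasurable F -> Cmeasurable G ->
  Cmeasurable (fun x => F x + G x).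
Proof.
move=> [F1 F2] [G1 G2]; split.
  by under eq_fun do rewrite ReCD; exact: measurable_funD.
by under eq_fun do rewrite ImCD; exact: measurable_funD.
Qed.

Lemma CmeasurableM F G : Cmeasurable F -> Cmeasurable G ->
  Cmeasurable (fun x => F x * G x).
Proof.
move=> [F1 F2] [G1 G2]; split.
  by under eq_fun do rewrite ReCM; apply: measurable_funB; exact: measurable_funM.
by under eq_fun do rewrite ImCM; apply: measurable_funD; exact: measurable_funM.
Qed.

Lemma Cmeasurable_expi (f : T -> R) : measurable_fun setT f ->
  Cmeasurable (fun x => expi (f x)).
Proof.
move=> mf; split => /=.
  apply: (measurableT_comp _ mf).
  by apply: continuous_measurable_fun; exact: continuous_cos.
apply: (measurableT_comp _ mf).
by apply: continuous_measurable_fun; exact: continuous_sin.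
Qed.

Lemma Cmeasurable_realC (f : T -> R) : measurable_fun setT f ->
  Cmeasurable (fun x => (f x)%:C%C).
Proof. by move=> mf; split => //=; exact: measurable_cst. Qed.

Lemma measurable_normc F : Cmeasurable F -> measurable_fun setT (fun x => normc (F x)).
Proof.
move=> [F1 F2]; under eq_fun do rewrite normc_ReIm.
apply: (@measurableT_comp _ _ _ _ _ _ (@Num.sqrt R)).
  by apply: continuous_measurable_fun; exact: sqrt_continuous.
by apply: measurable_funD; exact: measurable_funX.
Qed.

End Cmeasurable.

Lemma Cmeasurable_comp d1 d2 (T1 : measurableType d1) (T2 : measurableType d2)
    (R : realType) (F : T2 -> R[i]) (g : T1 -> T2) :
  Cmeasurable F -> measurable_fun setT g -> Cmeasurable (fun x => F (g x)).
Proof. by move=> [F1 F2] mg; split; [exact: (measurableT_comp F1)|exact: (measurableT_comp F2)]. Qed.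

Section Cintegral.
Context {R : realType} (n : nat).
Local Notation V := 'rV[R]_n.
Local Notation leb := (@lebesgue_rV R n).
Implicit Types F G : V -> R[i].

Lemma le_Cintegrable F (g : V -> R) : Cmeasurable F ->
  (forall x, normc (F x) <= g x) -> leb.-integrable setT (EFin \o g) ->
  Cintegrable F.
Proof.
move=> [F1 F2] Fg ig; split.
  by apply: (le_integrableR F1) ig => x; exact: le_trans (normr_Re_le _) (Fg x).
by apply: (le_integrableR F2) ig => x; exact: le_trans (normr_Im_le _) (Fg x).
Qed.

Lemma Cintegrable_Cmeasurable F : Cintegrable F -> Cmeasurable F.
Proof.
by move=> [/integrableP[F1 _] /integrableP[F2 _]]; split; exact/measurable_EFinP.
Qed.

Lemma Cintegrable_normc F : Cintegrable F ->
  leb.-integrable setT (EFin \o (fun x => normc (F x))).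
Proof.
move=> iF; have mF := Cintegrable_Cmeasurable iF.
apply: (@le_integrableR _ _ _ _ _ (fun x => `|Re (F x)| + `|Im (F x)|)).
- exact: measurable_normc.
- by move=> x; rewrite ger0_norm ?normc_ge0// normc_le_add.
- case: iF => F1 F2; have := integrableD measurableT (integrable_abse F1) (integrable_abse F2).
  by apply: eq_integrable.
Qed.

Lemma Cintegrable_bounded F G (M : R) : Cintegrable F -> Cmeasurable G ->
  (forall x, normc (G x) <= M) -> Cintegrable (fun x => G x * F x).
Proof.
move=> iF mG GM; apply: (@le_Cintegrable _ (fun x => M * normc (F x))).
- by apply: CmeasurableM => //; exact: Cintegrable_Cmeasurable.
- by move=> x; rewrite normcM ler_wpM2r// normc_ge0.
- exact: (integrableRZl _ (Cintegrable_normc iF)).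
Qed.

Lemma CintegrableZl F (c : R[i]) : Cintegrable F -> Cintegrable (fun x => c * F x).
Proof. by move=> iF; apply: (@Cintegrable_bounded _ _ (normc c)) => //; exact: Cmeasurable_cst. Qed.

Lemma CintegrableD F G : Cintegrable F -> Cintegrable G ->
  Cintegrable (fun x => F x + G x).
Proof.
move=> iF iG; apply: (@le_Cintegrable _ (fun x => normc (F x) + normc (G x))).
- by apply: CmeasurableD; exact: Cintegrable_Cmeasurable.
- by move=> x; exact: le_normcD.
- have := integrableD measurableT (Cintegrable_normc iF) (Cintegrable_normc iG).
  by apply: eq_integrable.
Qed.

Lemma eq_Cintegral F G : F =1 G -> Cintegral F = Cintegral G.
Proof. by move=> /funext->. Qed.

Lemma CintegralD F G : Cintegrable F -> Cintegrable G ->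
  Cintegral (fun x => F x + G x) = Cintegral F + Cintegral G.
Proof.
move=> [F1 F2] [G1 G2]; apply: eq_ReIm; rewrite ?ReCD ?ImCD/=.
  by under eq_Rintegral do rewrite ReCD; rewrite RintegralD.
by under eq_Rintegral do rewrite ImCD; rewrite RintegralD.
Qed.

Lemma CintegralZl F (c : R[i]) : Cintegrable F ->
  Cintegral (fun x => c * F x) = c * Cintegral F.
Proof.
move=> [F1 F2]; apply: eq_ReIm; rewrite ?ReCM ?ImCM/=.
  under eq_Rintegral do rewrite ReCM.
  by rewrite RintegralB//; [rewrite !RintegralZl|exact: integrableRZl|exact: integrableRZl].
under eq_Rintegral do rewrite ImCM.
by rewrite RintegralD//; [rewrite !RintegralZl|exact: integrableRZl|exact: integrableRZl].
Qed.

(** The factor 2 comes from bounding the real and the imaginary part separately; this crude constant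
    serves only to get boundedness. *)
Lemma normc_Cintegral_le F : Cintegrable F ->
  normc (Cintegral F) <= 2 * \int[leb]_x normc (F x).
Proof.
move=> iF; have iN := Cintegrable_normc iF.
have [F1 F2] := iF.
rewrite (le_trans (normc_le_add _))//= mulr_natl mulr2n lerD//.
  rewrite (le_trans (le_normr_Rintegral _ F1))// le_Rintegral//.
    exact: (integrable_abse F1).
  by move=> x _; exact: normr_Re_le.
rewrite (le_trans (le_normr_Rintegral _ F2))// le_Rintegral//.
  exact: (integrable_abse F2).
by move=> x _; exact: normr_Im_le.
Qed.

Lemma cvg_Cintegral (F_ : nat -> V -> R[i]) F (g : V -> R) :
  (forall k, Cmeasurable (F_ k)) -> (forall x, ccvg (F_ ^~ x) (F x)) ->
  (forall k x, normc (F_ k x) <= g x) -> leb.-integrable setT (EFin \o g) ->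
  ccvg (fun k => Cintegral (F_ k)) (Cintegral F).
Proof.
move=> mF FF Fg ig; split => /=.
  have [||||] // := @cvg_Rintegral _ _ _ leb (fun k x => Re (F_ k x)) (fun x => Re (F x)) g.
  - by move=> k; case: (mF k).
  - by move=> x; case: (FF x).
  - by move=> k x; rewrite (le_trans (normr_Re_le _)).
have [||||] // := @cvg_Rintegral _ _ _ leb (fun k x => Im (F_ k x)) (fun x => Im (F x)) g.
- by move=> k; case: (mF k).
- by move=> x; case: (FF x).
- by move=> k x; rewrite (le_trans (normr_Im_le _)).
Qed.

Lemma Cintegral_Fubini (H : V -> V -> R[i]) (g h : V -> R) :
  Cmeasurable (fun z : V * V => H z.1 z.2) ->
  (forall x y, normc (H x y) <= g x * h y) ->
  leb.-integrable setT (EFin \o g) -> leb.-integrable setT (EFin \o h) ->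
  Cintegral (fun x => Cintegral (H x)) =
  Cintegral (fun y => Cintegral (fun x => H x y)).
Proof.
move=> [H1 H2] Hgh ig ih; apply: eq_ReIm => /=.
  apply: (Rintegral_Fubini H1 _ ig ih) => x y.
  exact: le_trans (normr_Re_le _) (Hgh _ _).
apply: (Rintegral_Fubini H2 _ ig ih) => x y.
exact: le_trans (normr_Im_le _) (Hgh _ _).
Qed.

Section affine.
Variables (a : V) (e : R).
Hypothesis e0 : 0 < e.

Lemma Cintegrable_affine F : Cintegrable F -> Cintegrable (fun x => F (a + e *: x)).
Proof. by move=> [F1 F2]; split; [exact: (integrable_affine a e0 F1)|exact: (integrable_affine a e0 F2)]. Qed.

Lemma Cintegral_affine F : Cintegrable F ->
  ((e ^+ n)%:C)%C * Cintegral (fun x => F (a + e *: x)) = Cintegral F.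
Proof.
move=> [F1 F2]; apply: eq_ReIm; rewrite ?ReCM ?ImCM/= mul0r ?subr0 ?addr0.
  exact: (Rintegral_affine a e0 F1).
exact: (Rintegral_affine a e0 F2).
Qed.

End affine.
End Cintegral.

(** * Directional derivatives and the vanishing integral of a partial derivative *)

Section line_derivative.
Context {R : realType} (V : normedModType R).
Implicit Types (f : V -> R) (x v : V).

(** Reduces directional derivatives to one real variable, where the mean value theorem and the
    instances of [is_derive] are available. *)
Lemma is_derive_line f x v (s d : R) :
  is_derive s (1 : R) (fun h : R => f (h *: v + x)) d <-> is_derive (s *: v + x) v f d.
Proof.
have E : (fun h => h^-1 *: (f (((h : R) *: v) + (s *: v + x)) - f (s *: v + x))) =
  (fun h => h^-1 *: ((fun h : R => f (h *: v + x)) (h *: (1 : R) + s) - f (s *: v + x))).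
  by apply/funext => h /=; rewrite [h *: 1]mulr1 scalerDl addrA.
split=> -[D1 D2]; split.
- by move: D1; rewrite /derivable/= -E.
- by rewrite -D2 /derive/= -E.
- by move: D1; rewrite /derivable/= E.
- by rewrite -D2 /derive/= E.
Qed.

Lemma is_derive_line0 f x v (d : R) :
  is_derive (0 : R) 1 (fun h : R => f (h *: v + x)) d <-> is_derive x v f d.
Proof. by rewrite is_derive_line scale0r add0r. Qed.

Lemma MVT_line f x v (h : R) : 0 < h -> (forall y, derivable f y v) ->
  exists2 c, 0 <= c <= h & f (h *: v + x) - f x = 'D_v f (c *: v + x) * h.
Proof.
move=> h0 fd.
have fl (s : R) : is_derive s (1 : R) (fun h : R => f (h *: v + x)) ('D_v f (s *: v + x)).
  by apply/is_derive_line; exact: derivableP.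
have [|c] := @MVT_segment _ (fun s : R => f (s *: v + x)) (fun s => 'D_v f (s *: v + x)) 0 h (ltW h0).
  apply: derivable_within_continuous => s _; exact: ex_derive.
rewrite in_itv/= subr0 scale0r add0r => ch E.
by exists c.
Qed.

Lemma cvg_difference_quotient f x v : derivable f x v ->
  k.+1%:R * (f (k.+1%:R^-1 *: v + x) - f x) @[k --> \oo] --> 'D_v f x.
Proof.
move=> fd.
have : (fun h : R => h^-1 *: (f (h *: v + x) - f x)) @ 0^' --> 'D_v f x by exact: fd.
move=> /cvgr_dnbhsP/(_ (fun k => k.+1%:R^-1)) H.
under eq_fun do rewrite -[X in X * _]invrK.
by apply: H; split => [k|]; [rewrite invr_eq0 pnatr_eq0|exact: cvg_harmonic].
Qed.

End line_derivative.

Section integral_partial.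
Context {R : realType} (n : nat).
Local Notation V := 'rV[R]_n.
Local Notation leb := (@lebesgue_rV R n).
Local Notation e_ i := (delta_mx ord0 i : V).

Lemma cauchyw_shift (x : V) (c : R) (i : 'I_n) : 0 <= c <= 1 ->
  cauchyw (c *: e_ i + x) <= 3 ^+ n * cauchyw x.
Proof.
move=> /andP[c0 c1]; rewrite /cauchyw (_ : 3 ^+ n = \prod_(j < n) (3 : R)); last first.
  by rewrite prodr_const card_ord.
rewrite -big_split/=.
apply: ler_prod => j _; rewrite invr_ge0 addr_ge0 ?sqr_ge0//=.
set d := (c *: e_ i) ord0 j.
have d1 : 0 <= d <= 1.
  by rewrite /d !mxE/=; case: (_ == _) => /=; rewrite ?mulr1 ?mulr0 ?c0 ?c1 ?lexx ?ler01.
rewrite mxE -/d -[leRHS]invrK lef_pV2 ?posrE ?invr_gt0 ?mulr_gt0 ?invr_gt0//; last 2 first.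
- by rewrite ltr_wpDr ?sqr_ge0.
- by rewrite ltr_wpDr ?sqr_ge0.
rewrite invfM invrK ler_pdivrMl//.
(* Origin of the constant 3: [3 (1 + (d + x)^2) - (1 + x^2) = 2 + (2 x + 3 d)^2 / 2 - 3 d^2 / 2],
   which is positive once [d^2 <= 1]. *)
have := sqr_ge0 (2 * (x ord0 j) + 3 * d); move: d1 => /andP[d0 d1].
have : d ^+ 2 <= 1 by rewrite expr_le1.
rewrite !expr2; nra.
Qed.

Lemma integral_shift (u : V -> R) (v : V) : leb.-integrable setT (EFin \o u) ->
  leb.-integrable setT (EFin \o (fun x => u (v + x))) /\
  \int[leb]_x u (v + x) = \int[leb]_x u x.
Proof.
move=> ui; split.
  have := integrable_affine v ltr01 ui.
  by apply: eq_integrable => // x _ /=; rewrite scale1r.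
rewrite -(Rintegral_affine v ltr01 ui) expr1n mul1r.
by under [RHS]eq_Rintegral do rewrite scale1r.
Qed.

(* The difference quotients of [u] along [e_i] have integral zero by translation
   invariance, and they converge to the derivative dominatedly. *)
Lemma Rintegral_partial0 (u : V -> R) (i : 'I_n) (M M' : R) :
  continuous u -> (forall x, derivable u x (e_ i)) ->
  (forall x, `|u x| <= M * cauchyw x) ->
  (forall x, `|'D_(e_ i) u x| <= M' * cauchyw x) ->
  \int[leb]_x 'D_(e_ i) u x = 0.
Proof.
move=> cu du uM duM.
have mu : measurable_fun setT u by exact: continuous_measurable_rV.
have ui : leb.-integrable setT (EFin \o u).
  by apply: (le_integrableR mu uM); apply: integrableRZl; exact: integrable_cauchyw.
pose q k (x : V) := k.+1%:R * (u (k.+1%:R^-1 *: e_ i + x) - u x).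
have q0 k : \int[leb]_x q k x = 0.
  have [ui' uE] := integral_shift (k.+1%:R^-1 *: e_ i) ui.
  rewrite RintegralZl//.
    by rewrite RintegralB// uE subrr mulr0.
  have := integrableB measurableT ui' ui.
  by apply: eq_integrable.
have k01 k : 0 < (k.+1%:R^-1 : R) <= 1.
  by rewrite invr_gt0 ltr0n/= invf_le1// ler1n.
have [||||_] := @cvg_Rintegral _ _ _ leb q ('D_(e_ i) u) (fun x => M' * (3 ^+ n * cauchyw x)).
- move=> k; apply: measurable_funM => //; apply: measurable_funB => //.
  apply: (measurableT_comp mu); have := measurable_affine_rV (k.+1%:R^-1 *: e_ i) 1.
  by under eq_fun do rewrite scale1r.
- by move=> x; exact: cvg_difference_quotient.
- move=> k x; have /andP[kp k1] := k01 k.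
  (* The quotient equals the derivative at a point shifted by at most 1, where [cauchyw] has grown
     by a factor of at most [3 ^+ n]; this is the common majorant. *)
  rewrite /q; have [c /andP[c0 ck] ->] := MVT_line x kp du.
  rewrite mulrCA mulfV// mulr1 (le_trans (duM _))// ler_wpM2l//.
    have := le_trans (normr_ge0 _) (duM x).
    by rewrite pmulr_lge0// cauchyw_gt0.
  by apply: cauchyw_shift; rewrite c0 (le_trans ck).
- by apply: integrableRZl; apply: integrableRZl; exact: integrable_cauchyw.
rewrite (_ : (fun k => _) = fun=> 0); last by apply/funext => k; exact: q0.
by move=> /(cvg_unique _ (cvg_cst _)) <-.
Qed.

End integral_partial.

(** * Decay of Schwartz functions and of their transforms *)

Section schwartz.
Context {R : realType} (n : nat).
Local Notation V := 'rV[R]_n.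
Local Notation leb := (@lebesgue_rV R n).
Local Notation e_ i := (delta_mx ord0 i : V).
Implicit Types g : V -> R.

Lemma schwartzR_partial g i : schwartzR g -> schwartzR (partial i g).
Proof.
have E alpha : partials alpha (partial i g) = partials (rcons alpha i) g.
  by rewrite /partials foldr_rcons.
by move=> [g1 g2]; split => alpha; rewrite E; [exact: g1|exact: g2].
Qed.

Lemma schwartzRB g h : schwartzR g -> schwartzR h -> schwartzR (fun x => g x - h x).
Proof.
move=> [g1 g2] [h1 h2].
have E alpha : partials alpha (fun x => g x - h x) =
    (fun x => partials alpha g x - partials alpha h x).
  elim: alpha => //= i alpha ->; apply/funext => x; rewrite /partial deriveB//;
    exact: diff_derivable.
split => [alpha x|alpha k].
  by rewrite E; apply: differentiableB; [exact: g1|exact: h1].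
have [M1 gM] := g2 alpha k; have [M2 hM] := h2 alpha k.
exists (M1 + M2) => x; rewrite E (le_trans _ (lerD (gM x) (hM x)))// -mulrDr.
by rewrite ler_wpM2l ?ler_normB// exprn_ge0// sqrtr_ge0.
Qed.

Lemma schwartzR_differentiable g x : schwartzR g -> differentiable g x.
Proof. by move=> [/(_ [::])]. Qed.

Lemma schwartzR_continuous g : schwartzR g -> continuous g.
Proof. by move=> gs x; apply: differentiable_continuous; exact: schwartzR_differentiable. Qed.

Lemma dotv_sqr_ge0 (x : V) : 0 <= dotv x x.
Proof. by apply: sumr_ge0 => i _; rewrite -expr2 sqr_ge0. Qed.

Lemma sqr_jbracket (x : V) : jbracket x ^+ 2 = 1 + dotv x x.
Proof. by rewrite sqr_sqrtr// addr_ge0// dotv_sqr_ge0. Qed.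

(** Each of the [n] factors [1 + x_i^2] is at most [jbracket x ^+ 2]. Hence the Schwartz seminorm of
    order [2 * n] yields domination by [cauchyw]. *)
Lemma cauchyw_jbracket (x : V) : 1 <= jbracket x ^+ (2 * n) * cauchyw x.
Proof.
rewrite exprM sqr_jbracket (_ : _ ^+ n = \prod_(i < n) (1 + dotv x x)); last first.
  by rewrite prodr_const card_ord.
rewrite -big_split/=.
apply: (le_trans (_ : 1 <= \prod_(i < n) 1)); first by rewrite big1.
apply: ler_prod => i _; rewrite ler01/= ler_pdivlMr ?mul1r ?ltr_wpDr ?sqr_ge0//.
rewrite lerD2l /dotv (bigD1 i)//= -expr2 lerDl sumr_ge0// => j _.
by rewrite -expr2 sqr_ge0.
Qed.

Lemma schwartzR_le_cauchyw g : schwartzR g ->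
  exists M, forall x, `|g x| <= M * cauchyw x.
Proof.
move=> [_ /(_ [::] (2 * n)%N)][M gM]; exists M => x.
rewrite (le_trans (_ : _ <= (jbracket x ^+ (2 * n) * `|g x|) * cauchyw x))//.
  by rewrite mulrAC ler_peMl// cauchyw_jbracket.
by rewrite ler_wpM2r ?(ltW (cauchyw_gt0 _))//; exact: gM.
Qed.

Lemma schwartzR_integrable g : schwartzR g -> leb.-integrable setT (EFin \o g).
Proof.
move=> gs; have [M gM] := schwartzR_le_cauchyw gs.
apply: (le_integrableR _ gM); last by apply: integrableRZl; exact: integrable_cauchyw.
by apply: continuous_measurable_rV; exact: schwartzR_continuous.
Qed.

Lemma dotv_line (x xi : V) (h : R) i :
  dotv (h *: e_ i + x) xi = h * xi ord0 i + dotv x xi.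
Proof.
rewrite /dotv (eq_bigr (fun j => (h *: e_ i) ord0 j * xi ord0 j + x ord0 j * xi ord0 j)); last first.
  by move=> j _; rewrite mxE mulrDl.
rewrite big_split/=; congr (_ + _).
rewrite (bigD1 i)//= big1 ?addr0; first by rewrite !mxE !eqxx mulr1.
by move=> j ji; rewrite !mxE (negbTE ji) andbF mulr0 mul0r.
Qed.

Lemma is_derive_cos_dotv (x xi : V) i :
  is_derive x (e_ i) (fun x => cos (dotv x xi)) (-1 * xi ord0 i * sin (dotv x xi)).
Proof.
apply/is_derive_line0; under eq_fun do rewrite dotv_line.
by apply: is_derive_eq; rewrite /GRing.scale/= mul0r add0r; ring.
Qed.

Lemma is_derive_sin_dotv (x xi : V) i :
  is_derive x (e_ i) (fun x => sin (dotv x xi)) (1 * xi ord0 i * cos (dotv x xi)).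
Proof.
apply/is_derive_line0; under eq_fun do rewrite dotv_line.
by apply: is_derive_eq; rewrite /GRing.scale/= mul0r add0r; ring.
Qed.

(** For real [g], this and [sinT] are the real part and minus the imaginary part of [fourier]. *)
Definition cosT g (xi : V) := \int[leb]_x (g x * cos (dotv x xi)).
Definition sinT g (xi : V) := \int[leb]_x (g x * sin (dotv x xi)).

Lemma continuous_dotv (xi : V) : continuous (fun x : V => dotv x xi).
Proof.
apply: (@continuous_big _ _ +%R _ _ _ _ _ (fun i (x : V) => x ord0 i * xi ord0 i)) => [|i _ x].
  by move=> p; apply: cvgD; [exact: cvg_fst|exact: cvg_snd].
by apply: continuousM; [exact: coord_continuous|exact: cst_continuous].
Qed.

Lemma norm_cos_le1 (a : R) : `|cos a| <= 1.
Proof. by rewrite ler_norml cos_geN1 cos_le1. Qed.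

Lemma norm_sin_le1 (a : R) : `|sin a| <= 1.
Proof. by rewrite ler_norml sin_geN1 sin_le1. Qed.

Lemma integrable_mul_trig (t : R -> R) g (xi : V) : continuous t ->
  (forall a, `|t a| <= 1) -> schwartzR g ->
  leb.-integrable setT (EFin \o (fun x => g x * t (dotv x xi))).
Proof.
move=> ct t1 gs.
apply: (@le_integrableR _ _ _ _ _ (fun x => `|g x|)).
- apply: continuous_measurable_rV => x; apply: continuousM.
    exact: schwartzR_continuous.
  by apply: (@continuous_comp _ _ _ _ t); [exact: continuous_dotv|exact: ct].
- by move=> x; rewrite normrM ler_piMr.
- exact: (integrable_abse (schwartzR_integrable gs)).
Qed.

(** Integration by parts: the partial derivative of [g x * t (dotv x xi)] has integral zero. The
    pair [t], [t'] stands for cosine and sine in either order, and [s] is the sign in the derivative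
    of [t]. *)
Lemma integral_partial_trig (s : R) (t t' : R -> R) g (xi : V) i :
  continuous t -> continuous t' ->
  (forall a, `|t a| <= 1) -> (forall a, `|t' a| <= 1) ->
  (forall x, is_derive x (e_ i) (fun x => t (dotv x xi)) (s * xi ord0 i * t' (dotv x xi))) ->
  schwartzR g ->
  \int[leb]_x (partial i g x * t (dotv x xi)) =
  - (s * xi ord0 i * \int[leb]_x (g x * t' (dotv x xi))).
Proof.
move=> ct ct' t1 t1' dt gs.
have gs' := schwartzR_partial i gs.
have [M gM] := schwartzR_le_cauchyw gs; have [M' gM'] := schwartzR_le_cauchyw gs'.
pose u (x : V) := g x * t (dotv x xi).
have dg x : derivable g x (e_ i) by apply: diff_derivable; exact: schwartzR_differentiable.
have du x : 'D_(e_ i) u x = partial i g x * t (dotv x xi) + s * xi ord0 i * (g x * t' (dotv x xi)).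
  rewrite deriveM//.
  by case: (dt x) => _ ->; rewrite /GRing.scale/= /partial; ring.
have iu := @Rintegral_partial0 R n u i M (M' + `|s * xi ord0 i| * M).
have : \int[leb]_x 'D_(e_ i) u x = 0.
  apply: iu.
  - move=> x; apply: continuousM; first exact: schwartzR_continuous.
    by apply: (@continuous_comp _ _ _ _ t); [exact: continuous_dotv|exact: ct].
  - by move=> x; apply: derivableM => //; case: (dt x).
  - by move=> x; rewrite normrM (le_trans _ (gM x))// ler_piMr.
  - move=> x; rewrite du mulrDl (le_trans (ler_normD _ _))// lerD//.
      by rewrite normrM (le_trans _ (gM' x))// ler_piMr.
    by rewrite normrM -mulrA ler_wpM2l// normrM (le_trans _ (gM x))// ler_piMr.
under eq_Rintegral do rewrite du.
rewrite RintegralD//; last 2 first.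
- exact: integrable_mul_trig.
- by apply: integrableRZl; exact: integrable_mul_trig.
rewrite RintegralZl//; last exact: integrable_mul_trig.
by move/eqP; rewrite addr_eq0 => /eqP.
Qed.

Lemma cosT_partial g i xi : schwartzR g -> cosT (partial i g) xi = xi ord0 i * sinT g xi.
Proof.
move=> gs; rewrite /cosT /sinT (integral_partial_trig (@continuous_cos R)
  (@continuous_sin R) norm_cos_le1 norm_sin_le1 (fun x => is_derive_cos_dotv x xi i) gs).
by ring.
Qed.

Lemma sinT_partial g i xi : schwartzR g -> sinT (partial i g) xi = - (xi ord0 i * cosT g xi).
Proof.
move=> gs; rewrite /cosT /sinT (integral_partial_trig (@continuous_sin R)
  (@continuous_cos R) norm_sin_le1 norm_cos_le1 (fun x => is_derive_sin_dotv x xi i) gs).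
by ring.
Qed.

(** The operator [1 - d_i^2]; on the transform side it multiplies by [1 + xi_i^2], the inverse of
    one factor of [cauchyw]. *)
Definition bessel i g (x : V) : R := g x - partial i (partial i g) x.

Lemma schwartzR_bessel i g : schwartzR g -> schwartzR (bessel i g).
Proof. by move=> gs; apply: schwartzRB => //; do 2 apply: schwartzR_partial. Qed.

Lemma cosT_bessel i g xi : schwartzR g ->
  cosT (bessel i g) xi = (1 + xi ord0 i ^+ 2) * cosT g xi.
Proof.
move=> gs; have gs1 := schwartzR_partial i gs; have gs2 := schwartzR_partial i gs1.
transitivity (cosT g xi - cosT (partial i (partial i g)) xi).
  rewrite /cosT -RintegralB//; first by apply: eq_Rintegral => x _; rewrite mulrBl.
    by apply: integrable_mul_trig => //; [exact: continuous_cos|exact: norm_cos_le1].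
  by apply: integrable_mul_trig => //; [exact: continuous_cos|exact: norm_cos_le1].
by rewrite cosT_partial// sinT_partial//; ring.
Qed.

Lemma sinT_bessel i g xi : schwartzR g ->
  sinT (bessel i g) xi = (1 + xi ord0 i ^+ 2) * sinT g xi.
Proof.
move=> gs; have gs1 := schwartzR_partial i gs; have gs2 := schwartzR_partial i gs1.
transitivity (sinT g xi - sinT (partial i (partial i g)) xi).
  rewrite /sinT -RintegralB//; first by apply: eq_Rintegral => x _; rewrite mulrBl.
    by apply: integrable_mul_trig => //; [exact: continuous_sin|exact: norm_sin_le1].
  by apply: integrable_mul_trig => //; [exact: continuous_sin|exact: norm_sin_le1].
by rewrite sinT_partial// cosT_partial//; ring.
Qed.

(** Applying [bessel] once for each coordinate gives a Schwartz function [G] whose transforms,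
    multiplied by [cauchyw], are those of [g]; and the transforms of [G] are bounded by the integral
    of its modulus. *)
Lemma trigT_le_cauchyw g : schwartzR g -> exists M, forall xi,
  `|cosT g xi| <= M * cauchyw xi /\ `|sinT g xi| <= M * cauchyw xi.
Proof.
move=> gs; pose G := foldr bessel g (index_enum 'I_n).
have [Gs GE] : schwartzR G /\ forall xi,
    cosT g xi = cosT G xi * cauchyw xi /\ sinT g xi = sinT G xi * cauchyw xi.
  rewrite /G /cauchyw; elim: (index_enum 'I_n) => [|i l [IH1 IH2]].
    by split=> // xi; rewrite !big_nil !mulr1.
  split; first exact: schwartzR_bessel.
  move=> xi; have [c s] := IH2 xi; rewrite big_cons cosT_bessel// sinT_bessel//.
  have x0 : 1 + xi ord0 i ^+ 2 != 0 by rewrite gt_eqF// ltr_wpDr// sqr_ge0.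
  by rewrite c s; split; rewrite /=; field.
have Gi := schwartzR_integrable Gs.
have iT t xi : continuous t -> (forall a, `|t a| <= 1) ->
    `|\int[leb]_x (G x * t (dotv x xi))| <= \int[leb]_x `|G x|.
  move=> ct t1; have it := integrable_mul_trig xi ct t1 Gs.
  rewrite (le_trans (le_normr_Rintegral _ it))// le_Rintegral//.
  - exact: (integrable_abse it).
  - exact: (integrable_abse Gi).
  - by move=> x _; rewrite normrM ler_piMr.
exists (\int[leb]_x `|G x|) => xi; have [-> ->] := GE xi.
by rewrite !normrM (ger0_norm (ltW (cauchyw_gt0 _))); split;
  rewrite ler_wpM2r ?(ltW (cauchyw_gt0 _))// iT//;
  by [exact: continuous_cos|exact: continuous_sin|exact: norm_cos_le1|exact: norm_sin_le1].
Qed.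

End schwartz.

(** * Continuity criteria and the unnormalised inverse transform *)

Section continuity.
Context {R : realType} (n : nat).
Local Notation V := 'rV[R]_n.

(** Dominated convergence speaks of sequences. If continuity failed at [x], points within
    [k.+1%:R^-1] of [x] with values far from [f x] would form a sequence contradicting the
    hypothesis. *)
Lemma sequentially_continuous_rV (f : V -> R) :
  (forall (x : V) (u_ : nat -> V), (forall i, u_ k ord0 i @[k --> \oo] --> x ord0 i) ->
     f (u_ k) @[k --> \oo] --> f x) -> continuous f.
Proof.
move=> fseq x; apply/(cvgrPdist_lt (FF := nbhs_filter x)) => e e0; apply: contrapT => nfe.
have bad (k : nat) : exists y : V, ball x k.+1%:R^-1 y /\ ~ (`|f x - f y| < e).
  apply: contrapT => nb; apply: nfe; apply/nbhs_ballP; exists k.+1%:R^-1.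
    by rewrite /= invr_gt0.
  by move=> y xy; apply: contrapT => fy; apply: nb; exists y.
have [u_ uP] := choice bad.
have /fseq : forall i, u_ k ord0 i @[k --> \oo] --> x ord0 i.
  move=> i; apply/cvgrPdist_lt => d d0.
  have /cvgrPdist_lt/(_ d d0) := @cvg_harmonic R; apply: filterS => k.
  rewrite sub0r normrN ger0_norm/= ?invr_ge0//; apply: le_lt_trans.
  by have [[_ /(_ ord0 i)/ltW]] := uP k.
move=> /cvgrPdist_lt/(_ e e0)[N _ /(_ N (leqnn N))]/=.
by have [] := uP N.
Qed.

Lemma continuous_complex (f : V -> R[i]) :
  continuous (fun x => Re (f x)) -> continuous (fun x => Im (f x)) ->
  continuous (f : V -> (R[i])^o).
Proof.
(* In the order of [R[i]] a positive number has zero imaginary part, so the tolerance is a real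
   one. *)
move=> cR cI x; apply/(cvgrPdist_lt (FF := nbhs_filter x)) => -[e e']; rewrite ltcE/= => /andP[/eqP-> e0].
have e20 : 0 < e / 2 by rewrite divr_gt0.
have /(cvgrPdist_lt (FF := nbhs_filter x))/(_ _ e20) h1 := cR x.
have /(cvgrPdist_lt (FF := nbhs_filter x))/(_ _ e20) h2 := cI x.
apply: filterS2 h1 h2 => y; rewrite -!ReCN -!ImCN -ReCD -ImCD => h1 h2.
rewrite ltcR; apply: le_lt_trans (normc_le_add _) _; lra.
Qed.

Lemma continuous_Re_Im (f : V -> R[i]) : continuous (f : V -> (R[i])^o) ->
  continuous (fun x => Re (f x)) /\ continuous (fun x => Im (f x)).
Proof.
move=> cf; split => x; apply/(cvgrPdist_lt (FF := nbhs_filter x)) => e e0; have e0C : 0 < e%:C%C :> R[i] by rewrite ltcR.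
  have /(cvgrPdist_lt (FF := nbhs_filter x))/(_ _ e0C) := cf x; apply: filterS => y.
  by rewrite -ReCN -ReCD ltcR; exact: le_lt_trans (normr_Re_le _).
have /(cvgrPdist_lt (FF := nbhs_filter x))/(_ _ e0C) := cf x; apply: filterS => y.
by rewrite -ImCN -ImCD ltcR; exact: le_lt_trans (normr_Im_le _).
Qed.

Lemma Cb0_Cmeasurable (f : V -> R[i]) : Cb0 f -> Cmeasurable f.
Proof.
by move=> [/continuous_Re_Im[cR cI] _]; split; exact: continuous_measurable_rV.
Qed.

End continuity.

Section inverse_transform.
Context {R : realType} (n : nat).
Local Notation V := 'rV[R]_n.
Local Notation leb := (@lebesgue_rV R n).

(** No power of 2 pi is included; the normalisation is divided out later through [inv_cst]. Since
    [fourier phi xi] is [iFT phi (- xi)], estimates for [iFT] serve both. *)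
Definition iFT (F : V -> R[i]) (x : V) : R[i] :=
  Cintegral (fun xi => expi (dotv x xi) * F xi).

Lemma dotvC (x y : V) : dotv x y = dotv y x.
Proof. by apply: eq_bigr => i _; rewrite mulrC. Qed.

Lemma dotvDl (x y z : V) : dotv (x + y) z = dotv x z + dotv y z.
Proof. by rewrite /dotv -big_split/=; apply: eq_bigr => i _; rewrite mxE mulrDl. Qed.

Lemma dotvZl (a : R) (x y : V) : dotv (a *: x) y = a * dotv x y.
Proof. by rewrite /dotv mulr_sumr; apply: eq_bigr => i _; rewrite mxE mulrA. Qed.

Lemma dotvNl (x y : V) : dotv (- x) y = - dotv x y.
Proof. by rewrite -scaleN1r dotvZl mulN1r. Qed.

Lemma fourierE (phi : V -> R[i]) xi : fourier phi xi = iFT phi (- xi).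
Proof. by apply: eq_Cintegral => x; rewrite dotvNl dotvC. Qed.

Lemma measurable_dotv d (T : measurableType d) (f g : T -> V) :
  measurable_fun setT f -> measurable_fun setT g ->
  measurable_fun setT (fun x => dotv (f x) (g x)).
Proof.
move=> mf mg; apply: measurable_sum => i.
by apply: measurable_funM; [exact: (measurableT_comp (measurable_rV_coord i) mf)
  |exact: (measurableT_comp (measurable_rV_coord i) mg)].
Qed.

Lemma Cmeasurable_expi_dotv (x : V) : Cmeasurable (fun xi : V => expi (dotv x xi)).
Proof. by apply: Cmeasurable_expi; exact: measurable_dotv. Qed.

Lemma Cintegrable_expi (F : V -> R[i]) x : Cintegrable F ->
  Cintegrable (fun xi => expi (dotv x xi) * F xi).
Proof.
move=> iF; apply: (@Cintegrable_bounded _ _ _ _ 1) => //.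
  exact: Cmeasurable_expi_dotv.
by move=> y; rewrite normc_expi.
Qed.

Lemma ccvg_iFT (F : V -> R[i]) (x : V) (u_ : nat -> V) : Cintegrable F ->
  (forall i, u_ k ord0 i @[k --> \oo] --> x ord0 i) ->
  ccvg (fun k => iFT F (u_ k)) (iFT F x).
Proof.
move=> iF ux; apply: (@cvg_Cintegral _ _ _ _ (fun xi => normc (F xi))).
- move=> k; apply: CmeasurableM; first exact: Cmeasurable_expi_dotv.
  exact: Cintegrable_Cmeasurable.
- move=> xi; apply: ccvgM; last exact: ccvg_cst.
  apply: ccvg_expi; rewrite /dotv.
  apply: (@cvg_big _ _ +%R _ _ _ _ _ _ (fun i k => u_ k ord0 i * xi ord0 i)) => [|i _].
    by move=> p; apply: cvgD; [exact: cvg_fst|exact: cvg_snd].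
  by apply: cvgM; [exact: ux|exact: cvg_cst].
- by move=> k xi; rewrite normcM normc_expi mul1r.
- exact: Cintegrable_normc.
Qed.

Lemma continuous_iFT (F : V -> R[i]) : Cintegrable F ->
  continuous (fun x => Re (iFT F x)) /\ continuous (fun x => Im (iFT F x)).
Proof.
by move=> iF; split; apply: sequentially_continuous_rV => x u_ ux;
  have [] := ccvg_iFT iF ux.
Qed.

Lemma normc_iFT_le (F : V -> R[i]) x : Cintegrable F ->
  normc (iFT F x) <= 2 * \int[leb]_xi normc (F xi).
Proof.
move=> iF; apply: le_trans (normc_Cintegral_le (Cintegrable_expi _ iF)) _.
by under eq_Rintegral do rewrite normcM normc_expi mul1r.
Qed.

Lemma Cb0_iFT (F : V -> R[i]) : Cintegrable F -> Cb0 (iFT F).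
Proof.
move=> iF; have [c1 c2] := continuous_iFT iF.
split; first exact: continuous_complex.
by exists (2 * \int[leb]_xi normc (F xi)) => x; exact: normc_iFT_le.
Qed.

Lemma schwartz_Cintegrable (phi : V -> R[i]) : schwartz phi -> Cintegrable phi.
Proof. by move=> [p1 p2]; split; exact: schwartzR_integrable. Qed.

Lemma Cmeasurable_fourier (phi : V -> R[i]) : Cintegrable phi -> Cmeasurable (fourier phi).
Proof.
move=> ip; rewrite (_ : fourier phi = fun xi => iFT phi (0 + (-1) *: xi)); last first.
  by apply/funext => xi; rewrite add0r scaleN1r fourierE.
apply: Cmeasurable_comp; last exact: measurable_affine_rV.
exact/Cb0_Cmeasurable/Cb0_iFT.
Qed.

Lemma schwartz_fourier_le (phi : V -> R[i]) : schwartz phi ->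
  exists M, forall xi, normc (fourier phi xi) <= M * cauchyw xi.
Proof.
move=> [p1 p2]; have [M1 M1P] := trigT_le_cauchyw p1; have [M2 M2P] := trigT_le_cauchyw p2.
pose g1 x := Re (phi x); pose g2 x := Im (phi x).
have FE xi : Re (fourier phi xi) = cosT g1 xi + sinT g2 xi /\
             Im (fourier phi xi) = cosT g2 xi - sinT g1 xi.
  have cc := @continuous_cos R; have cs := @continuous_sin R.
  have nc := @norm_cos_le1 R; have ns := @norm_sin_le1 R.
  have i11 := integrable_mul_trig xi cc nc p1.
  have i12 := integrable_mul_trig xi cs ns p1.
  have i21 := integrable_mul_trig xi cc nc p2.
  have i22 := integrable_mul_trig xi cs ns p2.
  split; rewrite /= /cosT /sinT.
    rewrite -RintegralD//; apply: eq_Rintegral => x _.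
    by rewrite ReCM/= cosN sinN /g1 /g2; ring.
  rewrite -RintegralB//; apply: eq_Rintegral => x _.
  by rewrite ImCM/= cosN sinN /g1 /g2; ring.
exists ((M1 + M2) * 2) => xi; rewrite (le_trans (normc_le_add _))//.
have [-> ->] := FE xi; have [a b] := M1P xi; have [a' b'] := M2P xi.
have := ler_normD (cosT g1 xi) (sinT g2 xi); have := ler_normB (cosT g2 xi) (sinT g1 xi).
lra.
Qed.

Lemma Cintegrable_fourier (phi : V -> R[i]) : schwartz phi -> Cintegrable (fourier phi).
Proof.
move=> sp; have [M pM] := schwartz_fourier_le sp.
apply: (le_Cintegrable _ pM); first exact/Cmeasurable_fourier/schwartz_Cintegrable.
by apply: integrableRZl; exact: integrable_cauchyw.
Qed.

End inverse_transform.

(** * A supply of Schwartz functions: polynomials times [expR (- q)] *)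

Section polynomial_exponential.
Context {R : realType} (n : nat).
Local Notation V := 'rV[R]_n.
Local Notation e_ i := (delta_mx ord0 i : V).

Lemma line_coord (v x : V) (h : R) j :
  (h *: v + x) ord0 j = h * v ord0 j + x ord0 j.
Proof. by rewrite !mxE. Qed.

(** Generated inductively, because differentiability, stability under [partial] and polynomial
    growth then all follow by induction on the construction. *)
Inductive polyf : (V -> R) -> Prop :=
| polyf_cst c : polyf (fun=> c)
| polyf_coord i : polyf (fun x => x ord0 i)
| polyfD p q : polyf p -> polyf q -> polyf (fun x => p x + q x)
| polyfM p q : polyf p -> polyf q -> polyf (fun x => p x * q x).

Lemma differentiable_polyf p x : polyf p -> differentiable p x.
Proof.
elim=> [c|i|{}p q _ dp _ dq|{}p q _ dp _ dq].
- exact: differentiable_cst.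
- exact: differentiable_coord.
- exact: differentiableD.
- exact: differentiableM.
Qed.

Lemma polyf_partial i p : polyf p -> polyf (partial i p).
Proof.
have dv q x : polyf q -> derivable q x (e_ i).
  by move=> pq; apply: diff_derivable; exact: differentiable_polyf.
elim=> [c|j|{}p q pp dp pq dq|{}p q pp dp pq dq].
- rewrite (_ : partial i _ = fun=> 0); first exact: polyf_cst.
  by apply/funext => x; rewrite /partial derive_cst.
- rewrite (_ : partial i _ = fun=> (e_ i) ord0 j); first exact: polyf_cst.
  apply/funext => x; rewrite /partial.
  suff [_ ->//] : is_derive x (e_ i) (fun x : V => x ord0 j) ((e_ i) ord0 j).
  apply/is_derive_line0; under eq_fun do rewrite line_coord.
  move: ((e_ i) ord0 j) (x ord0 j) => a b; by apply: is_derive_eq; rewrite /GRing.scale/=; ring.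
- rewrite (_ : partial i _ = fun x => partial i p x + partial i q x).
    exact: polyfD.
  by apply/funext => x; exact: (deriveD (dv _ x pp) (dv _ x pq)).
- rewrite (_ : partial i _ = fun x => p x * partial i q x + q x * partial i p x).
    by apply: polyfD; exact: polyfM.
  by apply/funext => x; exact: (deriveM (dv _ x pp) (dv _ x pq)).
Qed.

Lemma jbracket_ge1 (x : V) : 1 <= jbracket x.
Proof. by rewrite -sqrtr1 ler_wsqrtr// lerDl dotv_sqr_ge0. Qed.

Lemma norm_coord_le_jbracket (x : V) i : `|x ord0 i| <= jbracket x.
Proof.
rewrite -sqrtr_sqr ler_wsqrtr// /dotv (bigD1 i)//= -expr2 addrCA lerDl.
by rewrite addr_ge0// sumr_ge0// => j _; rewrite -expr2 sqr_ge0.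
Qed.

Lemma polyf_le_jbracket p : polyf p ->
  exists C N, 0 <= C /\ forall x, `|p x| <= C * jbracket x ^+ N.
Proof.
have j0 (x : V) N : 0 <= jbracket x ^+ N.
  by apply: exprn_ge0; exact: le_trans ler01 (jbracket_ge1 _).
have jN (x : V) N N' : (N <= N')%N -> jbracket x ^+ N <= jbracket x ^+ N'.
  by move=> NN; rewrite ler_weXn2l// jbracket_ge1.
elim=> [c|i|{}p q _ [C [N [C0 pC]]] _ [D [M [D0 qD]]]|{}p q _ [C [N [C0 pC]]] _ [D [M [D0 qD]]]].
- by exists `|c|, 0%N; split => // x; rewrite expr0 mulr1.
- by exists 1, 1%N; split => // x; rewrite mul1r expr1 norm_coord_le_jbracket.
- exists (C + D), (maxn N M); split => [|x]; first exact: addr_ge0.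
  rewrite (le_trans (ler_normD _ _))// mulrDl lerD//.
    by rewrite (le_trans (pC x))// ler_wpM2l// jN// leq_maxl.
  by rewrite (le_trans (qD x))// ler_wpM2l// jN// leq_maxr.
- exists (C * D), (N + M)%N; split => [|x]; first exact: mulr_ge0.
  by rewrite normrM exprD mulrACA ler_pM.
Qed.

(** From [1 + y <= N (1 + y / N) <= N expR (y / N)], raised to the power [N]; hence the constant
    [N ^ N]. *)
Lemma expR_dominates_expn (N : nat) : exists C : R, 0 <= C /\
  forall y, 0 <= y -> (1 + y) ^+ N <= C * expR y.
Proof.
have [->|N0] := posnP N.
  exists 1; split=> // y y0; rewrite expr0 mul1r.
  by rewrite (le_trans _ (expR_ge1Dx _))// lerDl.
exists (N%:R ^+ N); split=> [|y y0]; first exact: exprn_ge0.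
have N1 : 1 <= N%:R :> R by rewrite ler1n.
have NN : 0 < N%:R :> R by rewrite ltr0n.
have yE : y = N%:R * (y / N%:R) by rewrite mulrC divfK ?gt_eqF.
rewrite [X in expR X]yE expRM_natl -exprMn lerXn2r ?nnegrE ?addr_ge0 ?mulr_ge0 ?expR_ge0 ?(ltW NN)//.
rewrite (@le_trans _ _ (N%:R * (1 + y / N%:R)))//.
  by rewrite mulrDr mulr1 mulrCA divff ?gt_eqF// mulr1 lerD2r.
by rewrite ler_wpM2l ?expR_ge1Dx// ltW.
Qed.

Lemma partial_pexp i p q : polyf p -> polyf q ->
  partial i (fun x => p x * expR (- q x)) =
  (fun x => (partial i p x + p x * (-1 * partial i q x)) * expR (- q x)).
Proof.
move=> pp pq; apply/funext => x.
have dp : derivable p x (e_ i) by apply: diff_derivable; exact: differentiable_polyf.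
have dq : derivable q x (e_ i) by apply: diff_derivable; exact: differentiable_polyf.
have dE : is_derive x (e_ i) (fun x => expR (- q x)) (- ('D_(e_ i) q x) * expR (- q x)).
  apply/is_derive_line0.
  have dl : is_derive (0:R) (1:R) (fun h : R => q (h *: e_ i + x)) ('D_(e_ i) q x).
    by apply/is_derive_line0; exact: derivableP.
  by apply: is_derive_eq; rewrite scale0r add0r /GRing.scale/=; ring.
case: dE => dE1 dE2.
by rewrite /partial (deriveM dp dE1) dE2 /GRing.scale/=; ring.
Qed.

Lemma partials_pexp alpha p q : polyf p -> polyf q ->
  exists2 p', polyf p' & partials alpha (fun x => p x * expR (- q x)) =
  (fun x => p' x * expR (- q x)).
Proof.
move=> pp pq; elim: alpha => /= [|i alpha [p' pp' ->]]; first by exists p.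
exists (fun x => partial i p' x + p' x * (-1 * partial i q x)).
  apply: polyfD; first exact: polyf_partial.
  by apply: polyfM => //; apply: polyfM; [exact: polyf_cst|exact: polyf_partial].
exact: partial_pexp.
Qed.

Lemma differentiable_pexp p q x : polyf p -> polyf q ->
  differentiable (fun x => p x * expR (- q x)) x.
Proof.
move=> pp pq; apply: differentiableM; first exact: differentiable_polyf.
apply: (@differentiable_comp _ _ _ _ (fun x => - q x) expR).
  by apply: differentiableN; exact: differentiable_polyf.
by apply/derivable1_diffP; exact: derivable_expR.
Qed.

(** Derivatives keep the form polynomial times [expR (- q)]. The growth hypothesis turns powers of
    [jbracket] into powers of [1 + q], and these are absorbed by the exponential. *)
Lemma schwartzR_pexp p q (C : R) : polyf p -> polyf q -> 0 <= C ->
  (forall x, 0 <= q x) -> (forall x, jbracket x ^+ 2 <= C * (1 + q x)) ->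
  schwartzR (fun x => p x * expR (- q x)).
Proof.
move=> pp pq C0 q0 qC; split => [alpha x|alpha k].
  have [p' pp' ->] := partials_pexp alpha pp pq.
  exact: differentiable_pexp.
have [p' pp' ->] := partials_pexp alpha pp pq.
have [D [N [D0 pD]]] := polyf_le_jbracket pp'.
have [B [B0 eB]] := expR_dominates_expn (k + N).
exists (D * (C ^+ (k + N) * B)) => x.
have j0 := le_trans ler01 (jbracket_ge1 x).
rewrite normrM (ger0_norm (expR_ge0 _)) mulrA expRN ler_pdivrMr ?expR_gt0//.
rewrite (@le_trans _ _ (D * jbracket x ^+ (k + N)))//.
  by rewrite exprD mulrCA ler_wpM2l// exprn_ge0.
rewrite -!mulrA ler_wpM2l//.
rewrite (@le_trans _ _ (C ^+ (k + N) * (1 + q x) ^+ (k + N)))//.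
  rewrite -exprMn (le_trans _ (_ : (jbracket x ^+ 2) ^+ (k + N) <= _))//.
    by rewrite -exprM ler_weXn2l ?jbracket_ge1// leq_pmull.
  by rewrite lerXn2r ?nnegrE ?exprn_ge0// (le_trans _ (qC x))// exprn_ge0.
by rewrite ler_wpM2l ?exprn_ge0// eB.
Qed.

Lemma polyf_sum (I : Type) (l : seq I) (p_ : I -> V -> R) : (forall i, polyf (p_ i)) ->
  polyf (fun x => \sum_(i <- l) p_ i x).
Proof.
move=> pp; elim: l => [|i l IH].
  by under eq_fun do rewrite big_nil; exact: polyf_cst.
by under eq_fun do rewrite big_cons; exact: polyfD.
Qed.

Lemma polyfX p k : polyf p -> polyf (fun x => p x ^+ k).
Proof.
move=> pp; elim: k => [|k IH]; first by under eq_fun do rewrite expr0; exact: polyf_cst.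
by under eq_fun do rewrite exprS; exact: polyfM.
Qed.

End polynomial_exponential.

(** * Functions whose integrals over all open boxes vanish *)

Section density.
Context d (T : measurableType d) {R : realType} (mu : {measure set T -> \bar R}).
Variable g : T -> \bar R.
Hypotheses (mg : measurable_fun setT g) (g0 : forall x, (0 <= g x)%E).

(** Turns the positive and the negative part of a function into measures, so that they can be
    compared by uniqueness of measures on a generating family. *)
Definition density (A : set T) : \bar R := (\int[mu]_(x in A) g x)%E.

Let density0 : density set0 = 0%E. Proof. exact: integral_set0. Qed.

Let density_ge0 A : (0 <= density A)%E. Proof. exact: integral_ge0. Qed.

Let density_sigma_additive : semi_sigma_additive density.
Proof.
move=> F mF tF mUF; rewrite /density ge0_integral_bigcup//; last exact: measurable_funTS.
by apply: is_cvg_nneseries => k _ _; exact: integral_ge0.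
Qed.

HB.instance Definition _ := isMeasure.Build _ _ _ density
  density0 density_ge0 density_sigma_additive.

End density.

Section boxes.
Context {R : realType} (n : nat).
Local Notation V := 'rV[R]_n.
Local Notation leb := (@lebesgue_rV R n).

Definition obox (a b : 'I_n -> R) : set V :=
  [set x | forall i, `]a i, b i[%classic (x ord0 i)].

Definition oboxes : set (set V) := [set A | exists a b, A = obox a b].

Lemma measurable_obox a b : measurable (obox a b).
Proof. by apply: (@measurable_rV_forall _ _ (fun i => `]a i, b i[%classic)). Qed.

Lemma obox_bounded (x : V) : exists k, forall k', (k <= k')%N ->
  obox (fun=> - k'%:R) (fun=> k'%:R) x.
Proof.
exists (Num.truncn (\sum_i `|x ord0 i|)).+1 => k' kk' i /=.
rewrite in_itv/= -ltr_norml.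
rewrite (le_lt_trans (_ : _ <= \sum_i `|x ord0 i|))//.
  by rewrite (bigD1 i)//= lerDl sumr_ge0.
by rewrite (lt_le_trans (truncnS_gt _))// ler_nat.
Qed.

Lemma obox_cover : \bigcup_k (obox (fun=> - k%:R) (fun=> k%:R)) = setT.
Proof.
rewrite -subTset => x _; have [k kP] := obox_bounded x.
by exists k => //; exact: kP.
Qed.

Lemma setI_closed_oboxes : setI_closed oboxes.
Proof.
move=> _ _ [a [b ->]] [a' [b' ->]].
exists (fun i => Num.max (a i) (a' i)), (fun i => Num.min (b i) (b' i)).
apply/seteqP; split => x /=.
  move=> [ab ab'] i; have := ab i; have := ab' i; rewrite /= !in_itv/= => /andP[? ?] /andP[? ?].
  by rewrite gt_max lt_min; apply/andP; split; apply/andP.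
by move=> H; split => i; have := H i; rewrite /= !in_itv/= gt_max lt_min =>
  /andP[/andP[? ?] /andP[? ?]]; apply/andP.
Qed.

Lemma measurable_rV_oboxes : @measurable _ V = <<s oboxes >>.
Proof.
apply/seteqP; split; last first.
  apply: smallest_sub; first exact: sigma_algebra_measurable.
  by move=> _ [a [b ->]]; exact: measurable_obox.
suff mid : measurable_fun (setT : set (g_sigma_algebraType oboxes))
    (fun x : g_sigma_algebraType oboxes => (x : V)).
  by move=> A mA; have := mid measurableT _ mA; rewrite setTI.
apply/measurable_fun_rVP => i.
apply: (measurability (@RGenOInfty.G R)); first exact: RGenOInfty.measurableE.
move=> _ [_] [r ->] <-; rewrite setTI.
(* The half-space of points with i-th coordinate above [r] is a countable union of boxes: [r] bounds
   the i-th side below, and all other bounds are [k] or its opposite. *)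
rewrite (_ : _ @^-1` _ = \bigcup_k (obox (fun j => if j == i then r else - k%:R) (fun=> k%:R)
   : set (g_sigma_algebraType oboxes))).
  apply: bigcupT_measurable => k; apply: sub_sigma_algebra.
  by eexists; eexists.
apply/seteqP; split => [x|x [k _ /(_ i)]]; last first.
  by rewrite /= !in_itv/= eqxx andbT => /andP[].
rewrite /= in_itv/= andbT => rx; have [k kP] := obox_bounded x; exists k => // j /=.
have := kP k (leqnn k) j; rewrite /= !in_itv/= => /andP[k1 ->].
by case: eqP => [->|]; rewrite ?rx ?k1.
Qed.

(** The densities given by the positive and negative parts agree on boxes, which are stable under
    intersection and generate the sigma-algebra; so they agree on every measurable set. *)
Lemma eq0_obox_integral_ae (f : V -> R) : leb.-integrable setT (EFin \o f) ->
  (forall a b, (\int[leb]_(x in obox a b) (f x)%:E = 0)%E) ->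
  ae_eq leb setT (EFin \o f) (cst 0%E).
Proof.
move=> fi f0; have mf : measurable_fun setT (EFin \o f) by case/integrableP: fi.
apply: integral_ae_eq => // E _ mE.
rewrite integral0 integralE.
have mp := measurable_funepos mf; have mn := measurable_funeneg mf.
pose m1 := density leb (EFin \o f)^\+%E.
have fin A : measurable A ->
    (\int[leb]_(x in A) (EFin \o f)^\+%E x)%E \is a fin_num /\
    (\int[leb]_(x in A) (EFin \o f)^\-%E x)%E \is a fin_num.
  move=> mA; split; apply: integrable_fin_num => //.
    by apply: integrable_funepos => //; exact: integrableS fi.
  by apply: integrable_funeneg => //; exact: integrableS fi.
suff -> : (\int[leb]_(x in E) (EFin \o f)^\+%E x = \int[leb]_(x in E) (EFin \o f)^\-%E x)%E.
  by rewrite subee//; case: (fin E mE).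
apply: (@measure_unique _ R _ oboxes (fun k => obox (fun=> - k%:R) (fun=> k%:R))
  measurable_rV_oboxes setI_closed_oboxes _ obox_cover
  (density leb (EFin \o f)^\+%E) (density leb (EFin \o f)^\-%E)) => //=.
- by move=> k; eexists; eexists.
- move=> _ [a [b ->]]; have := f0 a b; rewrite integralE.
  have [f1 f2] := fin _ (measurable_obox a b).
  by move/eqP; rewrite sube_eq// add0e => /eqP.
- move=> k; have [f1 _] := fin _ (measurable_obox (fun=> - k%:R) (fun=> k%:R)).
  by rewrite -ge0_fin_numE//; exact: integral_ge0.
Qed.

End boxes.

(** * Schwartz approximations of box indicators, and separation by Schwartz functions *)

Section bump.
Context {R : realType} (n : nat).
Local Notation V := 'rV[R]_n.
Local Notation leb := (@lebesgue_rV R n).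
Variables (c s : 'I_n -> R).
Hypothesis s0 : forall i, 0 < s i.

(** With [c i] the midpoint and [s i] the inverse half-length of a side, this is below 1 exactly
    when the coordinate lies in that open side. *)
Definition bump_base i (x : V) : R := ((x ord0 i + - c i) * s i) ^+ 2.

(* The weight [k.+1] makes [expR (- bump_exponent k x)] tend to 0 also where
   [bump_base i x = 1]; the square in the exponent beats that weight where
   [bump_base i x < 1]. *)
Definition bump_exponent (k : nat) (x : V) : R :=
  k.+1%:R * \sum_i bump_base i x ^+ (k.+1 ^ 2).

Lemma bump_base_ge0 i x : 0 <= bump_base i x. Proof. exact: sqr_ge0. Qed.

Lemma bump_term_le k x i : k.+1%:R * bump_base i x ^+ (k.+1 ^ 2) <= bump_exponent k x.
Proof.
rewrite ler_wpM2l// (bigD1 i)//= lerDl sumr_ge0// => j _.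
exact/exprn_ge0/bump_base_ge0.
Qed.

Lemma bump_exponent_ge0 k x : 0 <= bump_exponent k x.
Proof. by rewrite mulr_ge0// sumr_ge0// => j _; exact/exprn_ge0/bump_base_ge0. Qed.

Lemma polyf_bump k : polyf (bump_exponent k).
Proof.
apply: polyfM; first exact: polyf_cst.
apply: polyf_sum => i; apply: polyfX; apply: polyfX.
apply: polyfM; last exact: polyf_cst.
by apply: polyfD; [exact: polyf_coord|exact: polyf_cst].
Qed.

(** The factor 1 is the polynomial [p] of [schwartzR_pexp]; what has to be checked is the quadratic
    growth of the exponent. *)
Lemma schwartzR_bump k : schwartzR (fun x => 1 * expR (- bump_exponent k x)).
Proof.
(* Writing [x_i = y / s_i + c_i] with [y^2 = bump_base i x] gives [x_i^2 <= 2 s_i^-2 y^2 + 2 c_i^2];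
   [C] collects these coefficients. *)
pose C := \sum_i (2 * (s i)^-1 ^+ 2 + 2 * c i ^+ 2).
have C0 : 0 <= C.
  by apply: sumr_ge0 => i _; rewrite addr_ge0// mulr_ge0// sqr_ge0.
apply: (@schwartzR_pexp _ _ _ _ (1 + C)).
- exact: polyf_cst.
- exact: polyf_bump.
- by rewrite addr_ge0.
- exact: bump_exponent_ge0.
move=> x; rewrite sqr_jbracket mulrDl lerD//.
  by rewrite mul1r lerDl bump_exponent_ge0.
rewrite /C mulr_suml; apply: ler_sum => i _; rewrite -expr2.
set q := bump_exponent k x; have q0 : 0 <= q by exact: bump_exponent_ge0.
have U0 := bump_base_ge0 i x.
(* Either the base is at most 1, or it is bounded by its own power, which is part of the
   exponent. *)
have Uq : bump_base i x <= 1 + q.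
  have [U1|U1] := leP (bump_base i x) 1; first by rewrite (le_trans U1)// lerDl.
  rewrite (@le_trans _ _ (bump_base i x ^+ (k.+1 ^ 2)))//.
    by rewrite ler_eXnr// ?expn_gt0// ltW.
  rewrite (@le_trans _ _ (k.+1%:R * bump_base i x ^+ (k.+1 ^ 2)))//.
    by rewrite ler_peMl // ?ler1n // exprn_ge0.
  by rewrite (le_trans (bump_term_le k x i))// lerDr.
have xE : x ord0 i = (x ord0 i + - c i) * s i * (s i)^-1 + c i.
  by rewrite mulfK ?gt_eqF// subrK.
have : x ord0 i ^+ 2 <= 2 * (s i)^-1 ^+ 2 * bump_base i x + 2 * c i ^+ 2.
  rewrite [X in X ^+ 2]xE /bump_base; set y := _ * s i; set z := (s i)^-1.
  have := sqr_ge0 (y * z - c i); rewrite !expr2; lra.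
move/le_trans; apply; rewrite [leRHS]mulrDl lerD//.
  by rewrite ler_wpM2l// mulr_ge0// sqr_ge0.
by rewrite ler_peMr ?lerDl// mulr_ge0// sqr_ge0.
Qed.

(** From [a <= expR (- (1 - a))], the power is at most [expR (- (k+1)^2 (1 - a))], hence at most the
    inverse of [(k+1)^2 (1 - a)]; multiplied by [k+1] it still tends to 0. *)
Lemma cvg_bump_in (a : R) : 0 <= a < 1 ->
  k.+1%:R * a ^+ (k.+1 ^ 2) @[k --> \oo] --> (0 : R).
Proof.
move=> /andP[a0 a1]; have a10 : 0 < 1 - a by rewrite subr_gt0.
apply: (@squeeze_cvgr _ _ _ _ (fun=> 0) (fun k => (1 - a)^-1 * k.+1%:R^-1)).
- apply: nearW => k; apply/andP; split; first by rewrite mulr_ge0 ?exprn_ge0.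
  have k0 : 0 < k.+1%:R :> R by rewrite ltr0n.
  have aexp : a <= expR (- (1 - a)).
    by apply: le_trans (expR_ge1Dx _); lra.
  have : a ^+ (k.+1 ^ 2) <= expR (- (k.+1%:R ^+ 2 * (1 - a))).
    by rewrite -mulrN -natrX expRM_natl lerXn2r ?nnegrE ?expR_ge0.
  rewrite expRN => aN.
  have eN : k.+1%:R ^+ 2 * (1 - a) <= expR (k.+1%:R ^+ 2 * (1 - a)).
    by apply: le_trans (expR_ge1Dx _); rewrite lerDr.
  rewrite -invfM -ler_pdivlMl// -invfM.
  apply: le_trans aN _; rewrite lef_pV2 ?posrE ?expR_gt0// ?mulr_gt0//.
  by apply: le_trans eN; rewrite expr2; lra.
- exact: cvg_cst.
- rewrite -(mulr0 (1 - a)^-1); apply: cvgM; first exact: cvg_cst.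
  exact: cvg_harmonic.
Qed.

Lemma cvg_bump (x : V) :
  1 * expR (- bump_exponent k x) @[k --> \oo] -->
  (if [forall i, bump_base i x < 1] then 1 else 0 : R).
Proof.
under eq_fun do rewrite mul1r.
case: ifPn => [/forallP xin|]; last first.
  rewrite negb_forall => xout; have [i xi] := existsP xout.
  have x1 : 1 <= bump_base i x by rewrite leNgt.
  apply: (@squeeze_cvgr _ _ _ _ (fun=> 0) (fun k => k.+1%:R^-1)).
  - apply: nearW => k; rewrite expR_ge0/= expRN lef_pV2 ?posrE ?expR_gt0//.
    apply: le_trans (expR_ge1Dx _); rewrite (le_trans _ (_ : bump_exponent k x <= _))// ?lerDr//.
    apply: le_trans (bump_term_le k x i); rewrite ler_peMr//.
    exact: exprn_ege1.
  - exact: cvg_cst.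
  - exact: cvg_harmonic.
have -> : 1 = expR (- 0) :> R by rewrite oppr0 expR0.
apply: (@continuous_cvg _ _ _ _ _ _ (fun y => expR (- y))).
  apply: (@continuous_comp _ _ _ -%R expR); first exact: oppr_continuous.
  exact: continuous_expR.
rewrite /bump_exponent; under eq_fun do rewrite mulr_sumr.
have cD : continuous (fun p : R * R => p.1 + p.2).
  by move=> p; apply: cvgD; [exact: cvg_fst|exact: cvg_snd].
have S0 : \sum_(i < n) (0 : R) = 0 by rewrite big1.
have := @cvg_big R 'I_n +%R 0 xpredT cD nat \oo (index_enum 'I_n)
  (fun i k => k.+1%:R * bump_base i x ^+ (k.+1 ^ 2)) (fun=> 0).
rewrite S0; apply => i _.
by apply: cvg_bump_in; rewrite bump_base_ge0 xin.
Qed.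

End bump.

Section uniqueness.
Context {R : realType} (n : nat).
Local Notation V := 'rV[R]_n.
Local Notation leb := (@lebesgue_rV R n).

Lemma schwartzR_separates (f : V -> R) : leb.-integrable setT (EFin \o f) ->
  (forall g, schwartzR g -> \int[leb]_x (f x * g x) = 0) ->
  ae_eq leb setT (EFin \o f) (cst 0%E).
Proof.
move=> fi f0; apply: eq0_obox_integral_ae => // a b.
have [ab|/existsNP] := pselect (forall i, a i < b i); last first.
  move=> [i /negP]; rewrite -leNgt => ba.
  rewrite (_ : obox a b = set0) ?integral_set0//.
  apply/seteqP; split => // x /(_ i); rewrite /= in_itv/= => /andP[ax xb].
  by move: ba; rewrite leNgt (lt_trans ax xb).
(* Midpoints and inverse half-lengths, so that the bumps converge pointwise to the indicator of
   exactly this box. *)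
pose c i := (a i + b i) / 2; pose s i := 2 / (b i - a i).
have s0 i : 0 < s i by rewrite divr_gt0// subr_gt0.
have boxE x : [forall i, bump_base c s i x < 1] = (x \in obox a b).
  have E i : (bump_base c s i x < 1) = (a i < x ord0 i < b i).
    have ba : 0 < b i - a i by rewrite subr_gt0.
    rewrite /bump_base -real_normK ?num_real// expr_lt1// ltr_norml /s /c mulrA.
    rewrite ltr_pdivlMr// ltr_pdivrMr//.
    by apply/andP/andP => -[? ?]; split; lra.
  apply/forallP/idP => [H|/set_mem H i]; last by rewrite E; have := H i; rewrite /= in_itv.
  by apply/mem_set => i; rewrite /= in_itv/= -E.
pose phi k (x : V) := 1 * expR (- bump_exponent c s k x).
have phi1 k x : `|phi k x| <= 1.
  by rewrite /phi mul1r ger0_norm ?expR_ge0// expR_le1 oppr_le0 bump_exponent_ge0.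
have mf : measurable_fun setT f by apply/measurable_EFinP; case/integrableP: fi.
have [||||_] := @cvg_Rintegral _ _ _ leb (fun k x => f x * phi k x)
    (fun x => f x * (if [forall i, bump_base c s i x < 1] then 1 else 0)) (fun x => `|f x|).
- move=> k; apply: measurable_funM => //; apply: continuous_measurable_rV.
  exact/schwartzR_continuous/schwartzR_bump.
- by move=> x; apply: cvgM; [exact: cvg_cst|exact: cvg_bump].
- by move=> k x; rewrite normrM ler_piMr.
- exact: (integrable_abse fi).
under eq_fun do rewrite (f0 _ (schwartzR_bump c s0 _)).
move=> /(cvg_unique (@Rhausdorff R) (cvg_cst _)) I0.
rewrite integral_mkcond -[LHS]fineK.
  apply: (congr1 EFin); apply: (etrans _ (esym I0)); congr fine.
  apply: eq_integral => x _; rewrite boxE patchE.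
  by case: ifP; rewrite ?mulr1 ?mulr0.
apply: integrable_fin_num => //; apply/(integrable_mkcond _ (measurable_obox a b)).
by apply: (integrableS measurableT _ _ fi) => //; exact: measurable_obox.
Qed.

End uniqueness.

(** * Fourier inversion on Schwartz functions, up to a constant *)

Section inversion.
Context {R : realType} (n : nat).
Local Notation V := 'rV[R]_n.
Local Notation leb := (@lebesgue_rV R n).
Local Notation eps k := (k.+1%:R^-1 : R).

Definition gaussR (x : V) : R := 1 * expR (- dotv x x).
Definition gauss (x : V) : R[i] := ((gaussR x)%:C)%C.

Lemma schwartzR_gaussR : schwartzR gaussR.
Proof.
apply: (@schwartzR_pexp _ _ _ _ 1) => //.
- exact: polyf_cst.
- by apply: polyf_sum => i; apply: polyfM; exact: polyf_coord.
- by move=> x; exact: dotv_sqr_ge0.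
- by move=> x; rewrite sqr_jbracket mul1r.
Qed.

Lemma schwartz_realC (g : V -> R) : schwartzR g -> schwartz (fun x => ((g x)%:C)%C).
Proof.
move=> gs; split => //=; rewrite (_ : (fun=> 0) = (fun x => g x - g x)).
  exact: schwartzRB.
by apply/funext => x; rewrite subrr.
Qed.

Lemma schwartz_gauss : schwartz gauss.
Proof. exact/schwartz_realC/schwartzR_gaussR. Qed.

Lemma gaussR_gt0 x : 0 < gaussR x.
Proof. by rewrite /gaussR mul1r expR_gt0. Qed.

Lemma normc_gauss_le1 x : normc (gauss x) <= 1.
Proof.
rewrite normc_realC ger0_norm ?(ltW (gaussR_gt0 x))//.
by rewrite /gaussR mul1r expR_le1 oppr_le0 dotv_sqr_ge0.
Qed.

Lemma ccvg_affine (K : V -> R[i]) (a x : V) :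
  continuous (fun x => Re (K x)) -> continuous (fun x => Im (K x)) ->
  ccvg (fun k => K (a + eps k *: x)) (K a).
Proof.
have ax : (a + eps k *: x) @[k --> \oo] --> a.
  rewrite -[X in _ --> X]addr0 -(scale0r x); apply: cvgD; first exact: cvg_cst.
  by apply: cvgZl; exact: cvg_harmonic.
move=> cR cI; split.
  exact: (continuous_cvg _ (cR a) ax).
exact: (continuous_cvg _ (cI a) ax).
Qed.

(** The scale sits in the argument of the bounded continuous [K] instead of in the kernel [H], so
    dominated convergence with majorant [M * normc (H x)] is enough. *)
Lemma ccvg_approximate_identity (K H : V -> R[i]) (a : V) (M : R) :
  continuous (fun x => Re (K x)) -> continuous (fun x => Im (K x)) ->
  (forall x, normc (K x) <= M) -> Cintegrable H ->
  ccvg (fun k => Cintegral (fun x => K (a + eps k *: x) * H x)) (K a * Cintegral H).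
Proof.
move=> cR cI KM iH; rewrite -CintegralZl//.
have mK : Cmeasurable K by split; exact: continuous_measurable_rV.
apply: (@cvg_Cintegral _ _ _ _ (fun x => M * normc (H x))).
- move=> k; apply: CmeasurableM; last exact: Cintegrable_Cmeasurable.
  by apply: Cmeasurable_comp => //; exact: measurable_affine_rV.
- by move=> x; apply: ccvgM; [exact: ccvg_affine|exact: ccvg_cst].
- by move=> k x; rewrite normcM ler_wpM2r// normc_ge0.
- exact: (integrableRZl _ (Cintegrable_normc iH)).
Qed.

(** Classically equal to [(2 pi)^n], since the Gaussian takes the value 1 at the origin. *)
Definition inv_cst : R[i] := Cintegral (fourier gauss).

Lemma schwartz_bounded (phi : V -> R[i]) : schwartz phi ->
  exists M, forall x, normc (phi x) <= M.
Proof.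
move=> [[_ /(_ [::] 0%N)[M1 M1P]] [_ /(_ [::] 0%N)[M2 M2P]]].
exists (M1 + M2) => x; rewrite (le_trans (normc_le_add _))// lerD//.
  by have := M1P x; rewrite expr0 mul1r.
by have := M2P x; rewrite expr0 mul1r.
Qed.

(** Both sides equal the integral of [fourier psi * gauss] with [psi z = phi (xi + eps k *: z)]: the
    left one by rescaling, the right one by Fubini. *)
Lemma Cintegral_fourier_gauss (phi : V -> R[i]) (xi : V) k : schwartz phi ->
  Cintegral (fun x => expi (dotv xi x) * fourier phi x * gauss (eps k *: x)) =
  Cintegral (fun z => phi (xi + eps k *: z) * fourier gauss z).
Proof.
move=> sp; have e0 : 0 < eps k by rewrite invr_gt0.
have ip := schwartz_Cintegrable sp.
pose psi z := phi (xi + eps k *: z).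
have ipsi : Cintegrable psi by exact: Cintegrable_affine.
have ig := schwartz_Cintegrable schwartz_gauss.
have en0 : (((eps k) ^+ n)%:C)%C != 0 :> R[i].
  by rewrite eq_complex/= eqxx andbT expf_neq0// gt_eqF.
pose K w := fourier psi w * gauss w.
have iK : Cintegrable K.
  apply: (@Cintegrable_bounded _ _ _ _ (2 * \int[leb]_x normc (psi x))) => //.
    exact: Cmeasurable_fourier.
  by move=> w; rewrite fourierE; exact: normc_iFT_le.
transitivity (Cintegral K).
  (* The Jacobian of the outer substitution is matched with that of the inner one:
     [eps^n * fourier psi (eps x)] equals [expi (dotv xi x) * fourier phi x]. *)
  rewrite -(Cintegral_affine 0 e0 iK) -CintegralZl; last exact: Cintegrable_affine.
  apply: eq_Cintegral => x; rewrite add0r /K mulrA; congr (_ * _).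
  rewrite {1}/fourier -(Cintegral_affine xi e0); last first.
    by have := Cintegrable_expi (- x) ip; under eq_fun do rewrite dotvNl dotvC.
  rewrite mulrCA; congr (_ * _); rewrite -CintegralZl; last first.
    have := Cintegrable_affine xi e0 (Cintegrable_expi (- x) ip).
    by under eq_fun do rewrite dotvNl dotvC.
  apply: eq_Cintegral => z; rewrite mulrA -expiD; congr (expi _ * _).
  by rewrite dotvDl dotvZl [dotv z (_ *: x)]dotvC dotvZl [dotv x z]dotvC; ring.
rewrite /K.
under eq_Cintegral => w.
  rewrite mulrC -CintegralZl; last first.
    by have := Cintegrable_expi (- w) ipsi; under eq_fun do rewrite dotvNl dotvC.
  over.
rewrite (@Cintegral_Fubini _ _ _ (fun w => normc (gauss w)) (fun z => normc (psi z))).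
- apply: eq_Cintegral => z; rewrite -CintegralZl; last first.
    by have := Cintegrable_expi (- z) ig; under eq_fun do rewrite dotvNl dotvC.
  by apply: eq_Cintegral => w; rewrite dotvC /psi; ring.
- apply: CmeasurableM.
    by apply: Cmeasurable_comp measurable_fst; exact: Cintegrable_Cmeasurable.
  apply: CmeasurableM.
    apply: Cmeasurable_expi; apply: measurable_funN.
    by apply: measurable_dotv; [exact: measurable_snd|exact: measurable_fst].
  by apply: Cmeasurable_comp measurable_snd; exact: Cintegrable_Cmeasurable.
- by move=> w z; rewrite !normcM normc_expi mul1r.
- exact: Cintegrable_normc.
- exact: Cintegrable_normc.
Qed.

(* Insert the factor [gauss (eps k *: x)] into the inversion integral, move the
   transform onto it by Fubini and rescale: the kernel becomes an approximate
   identity of mass [inv_cst]. *)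
Lemma fourier_inversion (phi : V -> R[i]) (xi : V) : schwartz phi ->
  iFT (fourier phi) xi = inv_cst * phi xi.
Proof.
move=> sp; have ifp := Cintegrable_fourier sp; have [M pM] := schwartz_bounded sp.
have [c1 c2] : continuous (fun x => Re (phi x)) /\ continuous (fun x => Im (phi x)).
  by case: sp => s1 s2; split; exact: schwartzR_continuous.
(* One sequence of integrals, in the two forms of [Cintegral_fourier_gauss], tends to each side of
   the identity. *)
rewrite [RHS]mulrC; apply: ccvg_unique; last first.
  apply: (ccvg_approximate_identity xi c1 c2 pM).
  exact: (Cintegrable_fourier schwartz_gauss).
under [X in ccvg X _]eq_fun do rewrite -Cintegral_fourier_gauss//.
have ig := schwartz_Cintegrable schwartz_gauss.
apply: (@cvg_Cintegral _ _ _ _ (fun x => normc (fourier phi x))).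
- move=> k; apply: CmeasurableM; first apply: CmeasurableM.
  + exact: Cmeasurable_expi_dotv.
  + exact: Cintegrable_Cmeasurable.
  + have := measurable_affine_rV (0 : V) (eps k); under eq_fun do rewrite add0r.
    by apply: Cmeasurable_comp; exact: Cintegrable_Cmeasurable.
- move=> x; rewrite -[X in ccvg _ X]mulr1; apply: ccvgM; first exact: ccvg_cst.
  rewrite (_ : (fun k => gauss (eps k *: x)) = (fun k => gauss (0 + eps k *: x))); last first.
    by apply/funext => k; rewrite add0r.
  rewrite (_ : 1 = gauss (0 : V)); last first.
    by rewrite /gauss /gaussR -(scale0r (0 : V)) dotvZl mul0r oppr0 expR0 mul1r.
  apply: ccvg_affine; first exact: schwartzR_continuous schwartzR_gaussR.
  by move=> y; exact: cst_continuous.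
- move=> k x; rewrite normcM normcM normc_expi mul1r ler_piMr ?normc_ge0//.
  exact: normc_gauss_le1.
- exact: Cintegrable_normc.
Qed.

End inversion.

(** * Transposition of the transform, and why the inversion constant is nonzero *)

Section fourier_transform.
Context {R : realType} (n : nat).
Local Notation V := 'rV[R]_n.
Local Notation leb := (@lebesgue_rV R n).
Local Notation eps k := (k.+1%:R^-1 : R).
Implicit Types f F G : V -> R[i].

Lemma Cintegral_iFT_swap F G : Cintegrable F -> Cintegrable G ->
  Cintegral (fun x => iFT F x * G x) = Cintegral (fun x => F x * iFT G x).
Proof.
move=> iF iG.
under eq_Cintegral => x.
  by rewrite mulrC -CintegralZl; [over|exact: Cintegrable_expi].
rewrite (@Cintegral_Fubini _ _ _ (fun x => normc (G x)) (fun y => normc (F y))).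
- apply: eq_Cintegral => y; rewrite -CintegralZl; last exact: Cintegrable_expi.
  by apply: eq_Cintegral => x; rewrite dotvC; ring.
- apply: CmeasurableM.
    by apply: Cmeasurable_comp measurable_fst; exact: Cintegrable_Cmeasurable.
  apply: CmeasurableM.
    apply: Cmeasurable_expi.
    by apply: measurable_dotv; [exact: measurable_fst|exact: measurable_snd].
  by apply: Cmeasurable_comp measurable_snd; exact: Cintegrable_Cmeasurable.
- by move=> x y; rewrite !normcM normc_expi mul1r.
- exact: Cintegrable_normc.
- exact: Cintegrable_normc.
Qed.

Lemma eq_ae_Cintegral F G : Cmeasurable F -> Cmeasurable G ->
  (\forall x \ae leb, F x = G x) -> Cintegral F = Cintegral G.
Proof.
move=> [F1 F2] [G1 G2] FG; apply: eq_ReIm => /=; congr fine; apply: ae_eq_integral => //.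
- exact/measurable_EFinP.
- exact/measurable_EFinP.
- by apply: filterS FG => x ->.
- exact/measurable_EFinP.
- exact/measurable_EFinP.
- by apply: filterS FG => x ->.
Qed.

Lemma gauss_integral_neq0 : Cintegral (@gauss R n) != 0.
Proof.
apply/eqP => /(congr1 (@complex.Re R)) /= I0.
have gi := schwartzR_integrable (@schwartzR_gaussR R n).
have mg : measurable_fun setT (EFin \o @gaussR R n) by case/integrableP: gi.
have : (\int[leb]_x `|(EFin \o @gaussR R n) x|)%E = 0%E.
  under eq_integral do rewrite /= ger0_norm ?(ltW (gaussR_gt0 _))//.
  by rewrite -[LHS]fineK ?(integrable_fin_num measurableT gi)//; congr EFin.
move/ae_eq_integral_abs => /(_ measurableT mg)[N [mN N0 sN]].
have := @lebesgue_rVT_neq0 R n; rewrite -(_ : N = setT) ?N0 ?eqxx//.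
rewrite -subTset => x _; apply: sN => /= /(_ I) [] /eqP.
by rewrite gt_eqF// gaussR_gt0.
Qed.

(** If it were zero, inversion and transposition would annihilate the integral of the squared
    modulus of [fourier gauss], which would then vanish almost everywhere. Testing near the origin
    gives [fourier gauss 0 = 0], yet this value is the positive integral of the Gaussian. *)
Lemma inv_cst_neq0 : inv_cst n != 0 :> R[i].
Proof.
apply/eqP => c0; have sg := @schwartz_gauss R n.
have ig := schwartz_Cintegrable sg; have ifg := Cintegrable_fourier sg.
have mfg := Cintegrable_Cmeasurable ifg.
have cfg := Cb0_iFT ig.
have fg0 : \forall x \ae leb, fourier (@gauss R n) x = 0.
  have I0 : Cintegral (fun x => iFT (@gauss R n) x * fourier (@gauss R n) x) = 0.
    rewrite Cintegral_iFT_swap//.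
    rewrite (@eq_Cintegral _ _ _ (fun x => 0 * gauss x)).
      by rewrite CintegralZl// mul0r.
    by move=> x; rewrite fourier_inversion// c0 !mul0r mulr0.
  (* The Gaussian is real, so [iFT gauss] is the complex conjugate of [fourier gauss]. *)
  have sqE x : Re (iFT (@gauss R n) x * fourier (@gauss R n) x) =
      normc (fourier (@gauss R n) x) ^+ 2.
    rewrite ReCM normc_ReIm sqr_sqrtr ?addr_ge0 ?sqr_ge0//.
    have -> : Re (iFT (@gauss R n) x) = Re (fourier (@gauss R n) x).
      apply: eq_Rintegral => y _.
      by rewrite !ReCM/= cosN sinN dotvC !mulr0.
    have -> : Im (iFT (@gauss R n) x) = - Im (fourier (@gauss R n) x).
      rewrite fourierE -[RHS]mulN1r -RintegralZl//; last first.
        by case: (Cintegrable_expi (- x) ig).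
      apply: eq_Rintegral => y _.
      by rewrite !ImCM/= dotvNl cosN sinN; ring.
    by ring.
  have mN : measurable_fun setT (fun x => normc (fourier (@gauss R n) x) ^+ 2).
    exact/measurable_funX/measurable_normc.
  have iN : leb.-integrable setT (EFin \o (fun x => normc (fourier (@gauss R n) x) ^+ 2)).
    have [iR _] : Cintegrable (fun x => iFT (@gauss R n) x * fourier (@gauss R n) x).
      apply: (@Cintegrable_bounded _ _ _ _ (2 * \int[leb]_x normc (gauss x))) => //.
        exact: Cb0_Cmeasurable.
      by move=> x; exact: normc_iFT_le.
    by apply: eq_integrable iR => // x _ /=; rewrite -sqE.
  have : (\int[leb]_x `|(EFin \o (fun x => (normc (fourier (@gauss R n) x) ^+ 2)%R)) x|)%E = 0%E.
    under eq_integral do rewrite /= ger0_norm ?sqr_ge0//.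
    rewrite -[LHS]fineK ?(integrable_fin_num measurableT iN)//; congr EFin.
    have : \int[leb]_x Re (iFT (@gauss R n) x * fourier (@gauss R n) x) = 0.
      exact: (congr1 (@complex.Re R) I0).
    by under eq_Rintegral do rewrite sqE.
  move/ae_eq_integral_abs => /(_ measurableT); rewrite measurable_EFinP => /(_ mN).
  apply: filterS => x /(_ I) h; apply: ComplexField.Normc.eq0_normc.
  by apply/eqP; rewrite -sqrf_eq0; apply/eqP; exact: (congr1 fine h).
(* Passing from almost everywhere to the single point 0: averages against shrinking Gaussians do not
   see null sets, and they converge to a multiple of the value at 0. *)
have Z k : Cintegral (fun z => fourier (@gauss R n) (0 + eps k *: z) * gauss z) = 0.
  have e0 : 0 < eps k by rewrite invr_gt0.
  pose F x := fourier (@gauss R n) x * gauss ((eps k)^-1 *: x).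
  have mF : Cmeasurable F.
    apply: CmeasurableM => //.
    have := measurable_affine_rV (0 : V) (eps k)^-1; under eq_fun do rewrite add0r.
    by apply: Cmeasurable_comp; exact: Cintegrable_Cmeasurable.
  have iF : Cintegrable F.
    apply: (le_Cintegrable (g := fun x => normc (fourier (@gauss R n) x))) => //.
      by move=> x; rewrite normcM ler_piMr ?normc_ge0// normc_gauss_le1.
    exact: Cintegrable_normc.
  have F0 : Cintegral F = 0.
    rewrite (@eq_ae_Cintegral F (fun x => 0 * gauss x))//.
    - by rewrite CintegralZl// mul0r.
    - by apply: CmeasurableM; [exact: Cmeasurable_cst|exact: Cintegrable_Cmeasurable].
    - by apply: filterS fg0 => x; rewrite /F => ->; rewrite !mul0r.
  have en0 : (((eps k) ^+ n)%:C)%C != 0 :> R[i].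
    by rewrite eq_complex/= eqxx andbT expf_neq0// gt_eqF.
  have /eqP := Cintegral_affine 0 e0 iF; rewrite F0 mulf_eq0 (negbTE en0) => /eqP Z.
  rewrite -[RHS]Z; apply: eq_Cintegral => z; rewrite /F; congr (_ * gauss _).
  by rewrite add0r scalerA mulVf ?scale1r// gt_eqF.
have [f1 f2] : continuous (fun x => Re (fourier (@gauss R n) x)) /\
    continuous (fun x => Im (fourier (@gauss R n) x)).
  have cN (x : V) (u_ : nat -> V) : (forall i, u_ k ord0 i @[k --> \oo] --> x ord0 i) ->
      ccvg (fun k => fourier (@gauss R n) (u_ k)) (fourier (@gauss R n) x).
    move=> ux; rewrite fourierE; under eq_fun do rewrite fourierE.
    apply: ccvg_iFT => // i; rewrite mxE; under eq_fun do rewrite mxE.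
    exact: cvgN.
  by split; apply: sequentially_continuous_rV => x u_ /cN[].
have fb x : normc (fourier (@gauss R n) x) <= 2 * \int[leb]_x normc (gauss x).
  by rewrite fourierE; exact: normc_iFT_le.
have := ccvg_approximate_identity 0 f1 f2 fb ig.
under [X in ccvg X _]eq_fun do rewrite Z.
move=> /(ccvg_unique (ccvg_cst 0))/esym/eqP; rewrite mulf_eq0 => /orP[]; apply/negP; last first.
  exact: gauss_integral_neq0.
rewrite (_ : fourier (@gauss R n) 0 = Cintegral (@gauss R n)); first exact: gauss_integral_neq0.
apply: eq_Cintegral => x; rewrite dotvC -(scale0r (0 : V)) dotvZl mul0r oppr0.
rewrite (_ : expi 0 = 1) ?mul1r//.
by rewrite /expi cos0 sin0.
Qed.

End fourier_transform.

(** * Linearity, uniqueness and existence for [is_fourier]; membership in B^s *)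

Section is_fourier_theory.
Context {R : realType} (n : nat).
Local Notation V := 'rV[R]_n.
Local Notation leb := (@lebesgue_rV R n).
Implicit Types f g F G : V -> R[i].

Lemma Cb0_lin (a b : R[i]) f g : Cb0 f -> Cb0 g -> Cb0 (fun x => a * f x + b * g x).
Proof.
move=> [/continuous_Re_Im[f1 f2] [M fM]] [/continuous_Re_Im[g1 g2] [M' gM]].
have cM (c : R) (h : V -> R) : continuous h -> continuous (fun x => c * h x).
  by move=> ch x; apply: continuousM; [exact: cst_continuous|exact: ch].
have cD (h k : V -> R) : continuous h -> continuous k -> continuous (fun x => h x + k x).
  by move=> ch ck x; apply: continuousD; [exact: ch|exact: ck].
split.
  apply: continuous_complex.
    under eq_fun do rewrite ReCD !ReCM -!mulNr.
    by apply: (cD _ _ (cD _ _ (cM _ _ f1) (cM _ _ f2)) (cD _ _ (cM _ _ g1) (cM _ _ g2))).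
  under eq_fun do rewrite ImCD !ImCM.
  by apply: (cD _ _ (cD _ _ (cM _ _ f2) (cM _ _ f1)) (cD _ _ (cM _ _ g2) (cM _ _ g1))).
exists (normc a * M + normc b * M') => x.
by rewrite (le_trans (le_normcD _ _))// !normcM lerD// ler_wpM2l// normc_ge0.
Qed.

Lemma Cb0_mul_fourier f (phi : V -> R[i]) : Cb0 f -> schwartz phi ->
  Cintegrable (fun x => f x * fourier phi x).
Proof.
move=> bf sp; have [_ [M fM]] := bf.
apply: (Cintegrable_bounded (Cintegrable_fourier sp) _ fM).
exact: Cb0_Cmeasurable.
Qed.

Lemma Cintegrable_mul_schwartz F (phi : V -> R[i]) : Cintegrable F -> schwartz phi ->
  Cintegrable (fun x => F x * phi x).
Proof.
move=> iF sp; have [M pM] := schwartz_bounded sp.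
under eq_fun do rewrite mulrC.
apply: (Cintegrable_bounded iF _ pM).
exact/Cintegrable_Cmeasurable/schwartz_Cintegrable.
Qed.

Lemma is_fourier_lin (a b : R[i]) f g F G : Cb0 f -> Cb0 g ->
  is_fourier f F -> is_fourier g G ->
  is_fourier (fun x => a * f x + b * g x) (fun x => a * F x + b * G x).
Proof.
move=> bf bg [iF fF] [iG gG]; split.
  by apply: CintegrableD; exact: CintegrableZl.
move=> phi sp.
have E (h k H K : V -> R[i]) : Cintegrable (fun x => h x * H x) ->
    Cintegrable (fun x => k x * K x) ->
    H = K -> Cintegral (fun x => (a * h x + b * k x) * H x) =
    a * Cintegral (fun x => h x * H x) + b * Cintegral (fun x => k x * K x).
  move=> ih ik HK; rewrite -!CintegralZl// -CintegralD; try exact: CintegrableZl.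
  by apply: eq_Cintegral => x; rewrite HK; ring.
rewrite (E f g _ (fourier phi))//; try exact: Cb0_mul_fourier.
rewrite (E F G _ phi)//; try exact: Cintegrable_mul_schwartz.
by rewrite fF// gG.
Qed.

(** Real test functions act on the real and imaginary parts separately, so [schwartzR_separates]
    applies to each. *)
Lemma is_fourier_unique f F G : is_fourier f F -> is_fourier f G ->
  \forall x \ae leb, F x = G x.
Proof.
move=> [iF fF] [iG fG].
have FG (g : V -> R) : schwartzR g ->
    Cintegral (fun x => F x * ((g x)%:C)%C) = Cintegral (fun x => G x * ((g x)%:C)%C).
  by move=> /schwartz_realC sg; rewrite -fF// fG.
have iM H (g : V -> R) : Cintegrable H -> schwartzR g ->
    leb.-integrable setT (EFin \o (fun x => Re (H x) * g x)) /\
    leb.-integrable setT (EFin \o (fun x => Im (H x) * g x)).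
  move=> iH /schwartz_realC sg; have [i1 i2] := Cintegrable_mul_schwartz iH sg.
  split; [apply: eq_integrable i1|apply: eq_integrable i2] => // x _ /=.
    by rewrite ReCM/= mulr0 subr0.
  by rewrite ImCM/= mulr0 add0r.
have ReFG : ae_eq leb setT (EFin \o (fun x => Re (F x) - Re (G x))) (cst 0%E).
  apply: schwartzR_separates.
    by have := integrableB measurableT iF.1 iG.1; exact: eq_integrable.
  move=> g sg; under eq_Rintegral do rewrite mulrBl.
  have [? _] := iM _ _ iF sg; have [? _] := iM _ _ iG sg.
  rewrite RintegralB//; apply/eqP; rewrite subr_eq0; apply/eqP.
  have : Re (Cintegral (fun x => F x * ((g x)%:C)%C)) =
         Re (Cintegral (fun x => G x * ((g x)%:C)%C)) by rewrite FG.
  rewrite [LHS](@eq_Rintegral _ _ _ leb setT (fun x => Re (F x) * g x)); last first.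
    by move=> x _; rewrite ReCM/= mulr0 subr0.
  by rewrite [RHS](@eq_Rintegral _ _ _ leb setT (fun x => Re (G x) * g x))// => x _;
    rewrite ReCM/= mulr0 subr0.
have ImFG : ae_eq leb setT (EFin \o (fun x => Im (F x) - Im (G x))) (cst 0%E).
  apply: schwartzR_separates.
    by have := integrableB measurableT iF.2 iG.2; exact: eq_integrable.
  move=> g sg; under eq_Rintegral do rewrite mulrBl.
  have [_ ?] := iM _ _ iF sg; have [_ ?] := iM _ _ iG sg.
  rewrite RintegralB//; apply/eqP; rewrite subr_eq0; apply/eqP.
  have : Im (Cintegral (fun x => F x * ((g x)%:C)%C)) =
         Im (Cintegral (fun x => G x * ((g x)%:C)%C)) by rewrite FG.
  rewrite [LHS](@eq_Rintegral _ _ _ leb setT (fun x => Im (F x) * g x)); last first.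
    by move=> x _; rewrite ImCM/= mulr0 add0r.
  by rewrite [RHS](@eq_Rintegral _ _ _ leb setT (fun x => Im (G x) * g x))// => x _;
    rewrite ImCM/= mulr0 add0r.
apply: filterS2 ReFG ImFG => x /(_ I) h1 /(_ I) h2; apply: eq_ReIm; apply/eqP; rewrite -subr_eq0; apply/eqP.
  exact: (congr1 fine h1).
exact: (congr1 fine h2).
Qed.

(** Transposition moves [iFT] from [F] onto [fourier phi], where inversion on Schwartz functions
    applies. *)
Lemma is_fourier_iFT F : Cintegrable F -> is_fourier (fun x => (inv_cst n)^-1 * iFT F x) F.
Proof.
move=> iF; split => // phi sp; have ifp := Cintegrable_fourier sp.
under eq_Cintegral do rewrite -mulrA.
have [_ [M iM]] := Cb0_iFT iF.
rewrite CintegralZl; last first.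
  by apply: (Cintegrable_bounded ifp _ iM); exact: Cb0_Cmeasurable (Cb0_iFT iF).
rewrite Cintegral_iFT_swap//.
rewrite (@eq_Cintegral _ _ _ (fun x => inv_cst n * (F x * phi x))); last first.
  by move=> x; rewrite fourier_inversion// mulrCA.
rewrite CintegralZl; last exact: Cintegrable_mul_schwartz.
by rewrite mulrA mulVf ?mul1r// inv_cst_neq0.
Qed.

Lemma Cb0_inverse F : Cintegrable F -> Cb0 (fun x => (inv_cst n)^-1 * iFT F x).
Proof.
move=> iF; have := Cb0_lin (inv_cst n)^-1 0 (Cb0_iFT iF) (Cb0_iFT iF).
by under eq_fun do rewrite mul0r addr0.
Qed.

Lemma is_fourier_fhat f F : is_fourier f F -> is_fourier f (fhat f).
Proof. by move=> fF; exact: (@xgetPex _ (fun=> 0) [set F | is_fourier f F] (ex_intro _ F fF)). Qed.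

Lemma fhat_ae f F : is_fourier f F -> \forall x \ae leb, fhat f x = F x.
Proof. by move=> fF; exact: is_fourier_unique (is_fourier_fhat fF) fF. Qed.

Lemma measurable_jbracket : measurable_fun setT (@jbracket R n).
Proof.
apply: (@measurableT_comp _ _ _ _ _ _ (@Num.sqrt R)).
  by apply: continuous_measurable_fun; exact: sqrt_continuous.
by apply: measurable_funD; [exact: measurable_cst|exact: measurable_dotv].
Qed.

Lemma measurable_jbracket_powR (s : R) : measurable_fun setT (fun x : V => jbracket x `^ s).
Proof. exact: (measurableT_comp (measurable_powR s) measurable_jbracket). Qed.

Lemma Cmeasurable_weighted s F : Cmeasurable F -> Cmeasurable (weighted s F).
Proof.
by move=> mF; apply: CmeasurableM => //; apply: Cmeasurable_realC; exact: measurable_jbracket_powR.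
Qed.

Lemma normc_weighted s F x : normc (weighted s F x) = jbracket x `^ s * normc (F x).
Proof. by rewrite normcM normc_realC ger0_norm// powR_ge0. Qed.

Lemma Cintegrable_L1norm F : Cmeasurable F -> (L1norm F < +oo)%E -> Cintegrable F.
Proof.
move=> mF Foo; apply: (le_Cintegrable mF (g := fun x => normc (F x))) => //.
apply/integrableP; split; first exact/measurable_EFinP/measurable_normc.
by under eq_integral do rewrite /= ger0_norm ?normc_ge0//.
Qed.

Lemma L1norm_lty F : Cintegrable F -> (L1norm F < +oo)%E.
Proof.
move=> /Cintegrable_normc/integrableP[_]; apply: le_lt_trans.
by rewrite /L1norm; under [leRHS]eq_integral do rewrite /= ger0_norm ?normc_ge0//.
Qed.

Lemma L1norm_ge0 F : (0 <= L1norm F)%E.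
Proof. by apply: integral_ge0 => x _; rewrite lee_fin normc_ge0. Qed.

Lemma le_L1norm F (g : V -> R) : Cmeasurable F -> measurable_fun setT g ->
  (forall x, normc (F x) <= g x) -> (L1norm F <= \int[leb]_x (g x)%:E)%E.
Proof.
move=> mF mg Fg; apply: ge0_le_integral => //.
- by move=> x _; rewrite lee_fin normc_ge0.
- exact/measurable_EFinP/measurable_normc.
- exact/measurable_EFinP.
- by move=> x _; rewrite lee_fin.
Qed.

Lemma eq_ae_L1norm F G : Cmeasurable F -> Cmeasurable G ->
  (\forall x \ae leb, F x = G x) -> L1norm F = L1norm G.
Proof.
move=> mF mG FG; apply: ge0_ae_eq_integral => //.
- exact/measurable_EFinP/measurable_normc.
- exact/measurable_EFinP/measurable_normc.
- by move=> x _; rewrite lee_fin normc_ge0.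
- by move=> x _; rewrite lee_fin normc_ge0.
- by apply: filterS FG => x ->.
Qed.

(** Frees the norm from the representative chosen by [fhat]: any explicit transform computes it. *)
Lemma L1norm_weighted_fhat s f F : is_fourier f F ->
  L1norm (weighted s (fhat f)) = L1norm (weighted s F).
Proof.
move=> fF; apply: eq_ae_L1norm.
- apply: Cmeasurable_weighted; apply: Cintegrable_Cmeasurable.
  by case: (is_fourier_fhat fF).
- by apply: Cmeasurable_weighted; apply: Cintegrable_Cmeasurable; case: fF.
- by apply: filterS (fhat_ae fF) => x; rewrite /weighted => ->.
Qed.

Lemma Bspace_intro s f F : Cb0 f -> is_fourier f F ->
  (L1norm (weighted s F) < +oo)%E -> nset (Bspace n s) f.
Proof.
move=> bf fF Foo; split => //; first by exists F.
apply: Cintegrable_L1norm; last by rewrite (L1norm_weighted_fhat _ fF).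
apply: Cmeasurable_weighted; apply: Cintegrable_Cmeasurable.
by case: (is_fourier_fhat fF).
Qed.

Lemma Bspace_fhat s f : nset (Bspace n s) f ->
  [/\ Cb0 f, is_fourier f (fhat f), Cmeasurable (fhat f) &
      (L1norm (weighted s (fhat f)) < +oo)%E].
Proof.
move=> [bf [F fF] iw]; have ff := is_fourier_fhat fF; split => //.
  by apply: Cintegrable_Cmeasurable; case: ff.
exact: L1norm_lty.
Qed.

End is_fourier_theory.

(** * Convergence of power integrals on the half-line *)

Section power_integrals.
Context {R : realType}.
Local Notation mu := (@lebesgue_measure R).

Lemma integral_powR_segment (p x y : R) : p != 0 -> 0 < x -> x < y ->
  (\int[mu]_(r in `[x, y]) (r `^ (p - 1))%:E = ((y `^ p - x `^ p) / p)%:E)%E.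
Proof.
move=> p0 x0 xy.
have dF (r : R) : 0 < r -> is_derive r (1 : R) (fun r : R => p^-1 * r `^ p) (r `^ (p - 1)).
  move=> r0; have dp := is_derive1_powR p r0.
  have := @is_deriveZ _ _ _ (fun r : R => r `^ p) p^-1 r 1 _ dp.
  by move/is_derive_eq; apply; rewrite /GRing.scale/= mulrA mulVf// mul1r.
have cpow (q r : R) : 0 < r -> {for r, continuous (fun r : R => r `^ q)}.
  move=> r0; apply/differentiable_continuous/derivable1_diffP; apply: derivable_powR.
  by rewrite in_itv/= r0.
rewrite (@continuous_FTC2 _ _ (fun r : R => p^-1 * r `^ p))//.
- by rewrite -EFinB -mulrBr mulrC.
- apply: continuous_in_subspaceT => r; rewrite inE/= in_itv/= => /andP[xr _].
  by apply: cpow; exact: lt_le_trans xr.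
- have cF (r : R) : 0 < r -> {for r, continuous (fun r : R => p^-1 * r `^ p)}.
    by move=> r0; apply: continuousM; [exact: cst_continuous|exact: cpow].
  split.
  + move=> r; rewrite in_itv/= => /andP[xr _].
    by have [] := dF r (lt_trans x0 xr).
  + by apply: cvg_at_right_filter; exact: cF.
  + by apply: cvg_at_left_filter; apply: cF; exact: lt_trans xy.
- move=> r; rewrite in_itv/= => /andP[xr _].
  by rewrite derive1E; have [_ ->] := dF r (lt_trans x0 xr).
Qed.

(** Powers may be singular at 0 and the domain unbounded, so the domain is exhausted by compact
    intervals where the fundamental theorem of calculus holds. *)
Lemma integral_powR_le (p C : R) (x y : nat -> R) (D : set R) :
  p != 0 -> (forall k, 0 < x k <= y k) -> (forall k, (y k `^ p - x k `^ p) / p <= C) ->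
  nonincreasing_seq x -> nondecreasing_seq y -> \bigcup_k `[x k, y k]%classic = D ->
  (\int[mu]_(r in D) (r `^ (p - 1))%:E <= C%:E)%E.
Proof.
move=> p0 xy yxC nx ny <-.
have := @ge0_nondecreasing_set_cvg_integral _ (measurableTypeR R) R (fun k => `[x k, y k]%classic)
  (fun r => (r `^ (p - 1))%:E) mu.
move=> H; have {H} H : (\int[mu]_(r in `[x i, y i]) (r `^ (p - 1))%:E)%E @[i --> \oo] -->
    (\int[mu]_(r in \bigcup_i `[x i, y i]%classic) (r `^ (p - 1))%:E)%E.
  apply: H.
  - move=> i j ij; apply/subsetPset; apply: subset_itv; rewrite bnd_simp.
      exact: nx.
    exact: ny.
  - by move=> i; exact: measurable_itv.
  - by move=> i; apply/measurable_EFinP/measurable_funTS; exact: measurable_powR.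
  - by move=> i r _; rewrite lee_fin powR_ge0.
rewrite -(cvg_lim _ H)//; apply: lime_le; first by apply/cvg_ex; eexists; exact: H.
(* The interval can reduce to a point, as it does at [k = 0] in both applications. *)
apply: nearW => k; have /andP[x0] := xy k; rewrite le_eqVlt => /predU1P[xE|lt].
  rewrite xE set_itv1 integral_set1 lee_fin.
  by have := yxC k; rewrite xE subrr mul0r.
by rewrite integral_powR_segment// lee_fin.
Qed.

Lemma integral_powR_01 (a : R) : 0 < a ->
  (\int[mu]_(r in `]0%R, 1%R]) (r `^ (a - 1))%:E <= (a^-1)%:E)%E.
Proof.
move=> a0; apply: (@integral_powR_le a _ (fun k => k.+1%:R^-1) (fun=> 1)).
- by rewrite gt_eqF.
- by move=> k; rewrite invr_gt0 ltr0n/= invf_le1// ler1n.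
- by move=> k; rewrite powR1/= -[leRHS]mul1r ler_wpM2r ?invr_ge0 ?(ltW a0)// ?gerBl ?powR_ge0.
- by move=> i j ij; rewrite lef_pV2 ?posrE// ler_nat ltnS.
- by move=> i j ij.
apply/seteqP; split => [r [k _]|r]; rewrite /= !in_itv/=.
  by move=> /andP[kr ->]; rewrite andbT (lt_le_trans _ kr)// invr_gt0.
move=> /andP[r0 r1]; exists (Num.truncn r^-1) => //=.
by rewrite in_itv/= r1 andbT -[leRHS]invrK lef_pV2 ?posrE ?invr_gt0// ltW// truncnS_gt.
Qed.

Lemma integral_powR_1y (b : R) : 0 < b ->
  (\int[mu]_(r in `[1%R, +oo[) (r `^ (- b - 1))%:E <= (b^-1)%:E)%E.
Proof.
move=> b0; apply: (@integral_powR_le (- b) _ (fun=> 1) (fun k => k.+1%:R)).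
- by rewrite oppr_eq0 gt_eqF.
- by move=> k; rewrite ltr01 ler1n.
- by move=> k; rewrite powR1/= invrN mulrN -mulNr opprB -[leRHS]mul1r ler_wpM2r ?invr_ge0 ?(ltW b0)// ?gerBl ?powR_ge0.
- by move=> i j ij.
- by move=> i j ij; rewrite ler_nat ltnS.
apply/seteqP; split => [r [k _]|r]; rewrite /= !in_itv/=.
  by move=> /andP[->].
rewrite andbT => r1; exists (Num.truncn r) => //=.
by rewrite in_itv/= r1/= ltW// truncnS_gt.
Qed.

Lemma integral_powR_min_lty (a b : R) : 0 < a -> 0 < b ->
  (\int[mu]_(r in `]0%R, +oo[) (Num.min (r `^ (a - 1)) (r `^ (- b - 1)))%:E < +oo)%E.
Proof.
move=> a0 b0.
have mp q : measurable_fun setT (fun r : R => r `^ q) by exact: measurable_powR.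
have mm : measurable_fun setT (fun r : R => (Num.min (r `^ (a - 1)) (r `^ (- b - 1)))%:E).
  by apply/measurable_EFinP; exact: measurable_minr.
have m0 r : (0 <= (Num.min (r `^ (a - 1)) (r `^ (- b - 1)))%:E)%E.
  by rewrite lee_fin le_min !powR_ge0.
rewrite (_ : `]0, +oo[%classic = `]0, 1]%classic `|` `]1, +oo[%classic); last first.
  by rewrite -itv_bndbnd_setU// bnd_simp.
rewrite ge0_integral_setU//=; last 2 first.
- exact: measurable_funTS.
- apply/disj_setPS => r [/=]; rewrite !in_itv/= => /andP[_ r1]; rewrite andbT.
  by rewrite ltNge r1.
apply: lte_add_pinfty.
  apply: (@le_lt_trans _ _ (a^-1)%:E); last exact: ltry.
  apply: (le_trans _ (integral_powR_01 a0)); apply: ge0_le_integral => //.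
  - exact: measurable_funTS.
  - by apply/measurable_EFinP; exact: measurable_funTS.
  - by move=> r _; rewrite lee_fin ge_min lexx.
apply: (@le_lt_trans _ _ (b^-1)%:E); last exact: ltry.
apply: (le_trans _ (integral_powR_1y b0)).
apply: (@le_trans _ _ (\int[mu]_(r in `]1%R, +oo[) (r `^ (- b - 1))%:E)%E).
  apply: ge0_le_integral => //.
  - exact: measurable_funTS.
  - by apply/measurable_EFinP; exact: measurable_funTS.
  - by move=> r _; rewrite lee_fin ge_min lexx orbT.
apply: ge0_subset_integral => //.
- by apply/measurable_EFinP; exact: measurable_funTS.
- by move=> r _; rewrite lee_fin powR_ge0.
- by apply: subset_itvr; rewrite bnd_simp.
Qed.

End power_integrals.

(** * The K-functional of two gauged subsets *)

Section K_functional.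
Context {R : realType} (E : zmodType) (X0 X1 : @nspace R E).
Hypotheses (X0_ge0 : forall f, (0 <= nnorm X0 f)%E) (X1_ge0 : forall f, (0 <= nnorm X1 f)%E).
Local Open Scope ereal_scope.

Lemma le_Kfun (x : \bar R) (rho : R) (f : E) :
  (forall g h, nset X0 g -> nset X1 h -> (g + h)%R = f ->
     x <= nnorm X0 g + rho%:E * nnorm X1 h) -> x <= Kfun X0 X1 rho f.
Proof. by move=> H; apply: le_ereal_inf_tmp => _ [g [h [gX hX gh ->]]]; exact: H. Qed.

Lemma Kfun_le (rho : R) (g h : E) : nset X0 g -> nset X1 h ->
  Kfun X0 X1 rho (g + h)%R <= nnorm X0 g + rho%:E * nnorm X1 h.
Proof. by move=> gX hX; apply: ereal_inf_lbound; exists g, h. Qed.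

Lemma Kfun_ge0 (rho : R) (f : E) : (0 <= rho)%R -> 0 <= Kfun X0 X1 rho f.
Proof.
move=> r0; apply: le_Kfun => g h _ _ _.
by rewrite adde_ge0// mule_ge0// lee_fin.
Qed.

Lemma Kfun_nondecreasing (rho rho' : R) (f : E) : (rho <= rho')%R ->
  Kfun X0 X1 rho f <= Kfun X0 X1 rho' f.
Proof.
move=> rr; apply: le_Kfun => g h gX hX <-; apply: le_trans (Kfun_le _ gX hX) _.
by rewrite leeD2l// lee_wpmul2r// lee_fin.
Qed.

Lemma Kweight_ge0 (theta rho : R) (f : E) : (0 < rho)%R ->
  0 <= Kweight X0 X1 theta f rho.
Proof.
move=> r0; rewrite /Kweight !mule_ge0 ?lee_fin ?powR_ge0 ?invr_ge0 ?(ltW r0)//.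
by rewrite Kfun_ge0// ltW.
Qed.

(** The infimum runs over an uncountable family; measurability in [rho] comes from monotonicity
    instead. *)
Lemma measurable_Kweight (theta : R) (g h : E) : nset X0 g -> nset X1 h ->
  nnorm X0 g < +oo -> nnorm X1 h < +oo ->
  measurable_fun (`]0%R, +oo[%classic : set (measurableTypeR R)) (Kweight X0 X1 theta (g + h)%R).
Proof.
move=> gX hX goo hoo; set f := (g + h)%R.
have Kfin rho : (0 <= rho)%R -> Kfun X0 X1 rho f \is a fin_num.
  move=> r0; rewrite ge0_fin_numE ?Kfun_ge0//.
  apply: le_lt_trans (Kfun_le rho gX hX) _; rewrite lte_add_pinfty//.
  by rewrite lte_mul_pinfty// ?lee_fin// ge0_fin_numE.
(* Truncating at 0 gives a finite nondecreasing function on the whole line that agrees with the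
   K-functional for [rho > 0]. *)
pose k (rho : R) := fine (Kfun X0 X1 (Num.max 0%R rho) f).
have mk : measurable_fun setT k.
  apply: nondecreasing_measurable => // x y xy.
  apply: fine_le; rewrite ?Kfin ?le_max ?lexx//.
  by apply: Kfun_nondecreasing; rewrite ge_max !le_max lexx/= xy orbT.
apply: (eq_measurable_fun (fun rho : measurableTypeR R => (rho `^ (- theta) * k rho * rho^-1)%:E)).
  move=> rho; rewrite inE/= in_itv/= andbT => r0.
  have r0' := ltW r0.
  by rewrite /Kweight /k (max_idPr r0') !EFinM fineK// Kfin.
apply/measurable_EFinP; apply: measurable_funM.
  apply: measurable_funM; first by apply: measurable_funTS; exact: measurable_powR.
  exact: measurable_funTS.
apply: open_continuous_measurable_fun; first exact: interval_open.
move=> r; rewrite inE/= in_itv/= andbT => r0.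
by apply: inv_continuous; rewrite gt_eqF.
Qed.

End K_functional.

(** * Two-sided bounds for the K-functional of B^r and B^t *)

Section Bspace_interpolation.
Context {R : realType} (n : nat).
Local Notation V := 'rV[R]_n.
Local Notation leb := (@lebesgue_rV R n).
Local Notation mu := (@lebesgue_measure R).
Implicit Types f g h : V -> R[i].

Lemma nnorm_Bspace_ge0 s f : (0 <= nnorm (Bspace n s) f)%E.
Proof. exact: L1norm_ge0. Qed.

Lemma jbracket_gt0 (x : V) : 0 < jbracket x.
Proof. exact: lt_le_trans ltr01 (jbracket_ge1 _). Qed.

Lemma Bspace_lin s (a b : R[i]) f g : nset (Bspace n s) f -> nset (Bspace n s) g ->
  nset (Bspace n s) (fun x => a * f x + b * g x).
Proof.
move=> fB gB; have [bf ff mf foo] := Bspace_fhat fB; have [bg gg mg goo] := Bspace_fhat gB.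
have iF := is_fourier_lin a b bf bg ff gg.
apply: (Bspace_intro (Cb0_lin a b bf bg) iF).
have [i1 i2] : Cintegrable (weighted s (fhat f)) /\ Cintegrable (weighted s (fhat g)).
  by split; apply: Cintegrable_L1norm => //; exact: Cmeasurable_weighted.
apply: L1norm_lty.
rewrite (_ : weighted s _ = fun x => a * weighted s (fhat f) x + b * weighted s (fhat g) x).
  by apply: CintegrableD; exact: CintegrableZl.
by apply/funext => x; rewrite /weighted; ring.
Qed.

Lemma BspaceB s f g : nset (Bspace n s) f -> nset (Bspace n s) g ->
  nset (Bspace n s) (f - g).
Proof.
move=> fB gB; have := Bspace_lin 1 (-1) fB gB.
by congr nset; apply/funext => x; rewrite mul1r mulN1r.
Qed.

Lemma le_Bspace r s f : r <= s -> nset (Bspace n s) f ->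
  nset (Bspace n r) f /\ (nnorm (Bspace n r) f <= nnorm (Bspace n s) f)%E.
Proof.
move=> rs fB; have [bf ff mf foo] := Bspace_fhat fB.
have le : (nnorm (Bspace n r) f <= nnorm (Bspace n s) f)%E.
  apply: le_L1norm.
  - exact: Cmeasurable_weighted.
  - by apply: measurable_normc; exact: Cmeasurable_weighted.
  - move=> x; rewrite !normc_weighted ler_wpM2r ?normc_ge0//.
    by rewrite ler_powR// jbracket_ge1.
split; last exact: le.
apply: (Bspace_intro bf ff).
exact: le_lt_trans le foo.
Qed.

Lemma Bspace0 (s : R) : nset (Bspace n s) (0 : V -> R[i]) /\
  nnorm (Bspace n s) (0 : V -> R[i]) = 0%E.
Proof.
have b0 : Cb0 (0 : V -> R[i]).
  split; first exact: cst_continuous.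
  by exists 0 => x; rewrite ComplexField.Normc.normc0.
have f0 : is_fourier (0 : V -> R[i]) 0.
  split; first by split; exact: integrable0.
  by move=> phi _; apply: eq_Cintegral => x; rewrite !mul0r.
have N0 : L1norm (weighted s (0 : V -> R[i])) = 0%E.
  rewrite /L1norm integral0_eq// => x _.
  by rewrite normc_weighted ComplexField.Normc.normc0 mulr0.
split; first by apply: (Bspace_intro b0 f0); rewrite N0 ltry.
by rewrite /= (L1norm_weighted_fhat _ f0).
Qed.

Lemma is_fourier_add s s' f g h : nset (Bspace n s) g -> nset (Bspace n s') h ->
  g + h = f -> Cb0 f /\ is_fourier f (fun x => fhat g x + fhat h x).
Proof.
move=> gB hB <-; have [bg fg _ _] := Bspace_fhat gB; have [bh fh _ _] := Bspace_fhat hB.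
have E : g + h = (fun x => 1 * g x + 1 * h x).
  by apply/funext => x; rewrite !mul1r.
rewrite E; split; first exact: Cb0_lin.
have := is_fourier_lin 1 1 bg bh fg fh.
by under [X in is_fourier _ X]eq_fun do rewrite !mul1r.
Qed.

(** A common minorant [m] of the two weights gives [m |f^| <= m |g^| + m |h^|], and each term is
    bounded by its own weighted norm, for every splitting at once. *)
Lemma Kfun_Bspace_ge r t f (rho : R) (m : V -> R) : 0 <= rho ->
  Cmeasurable (fhat f) -> measurable_fun setT m -> (forall x, 0 <= m x) ->
  (forall x, m x <= jbracket x `^ r) -> (forall x, m x <= rho * jbracket x `^ t) ->
  (\int[leb]_x (m x * normc (fhat f x))%:E <= Kfun (Bspace n r) (Bspace n t) rho f)%E.
Proof.
move=> r0 mf mm m0 mr mt; apply: le_Kfun => g h gB hB gh.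
have [_ fF] := is_fourier_add gB hB gh; have ae := fhat_ae fF.
have [_ _ mg _] := Bspace_fhat gB; have [_ _ mh _] := Bspace_fhat hB.
have mN F : Cmeasurable F -> measurable_fun setT (fun x => m x * normc (F x)).
  by move=> mF; apply: measurable_funM => //; exact: measurable_normc.
have mW q F : Cmeasurable F ->
    measurable_fun setT (fun x => (normc (weighted q F x))%:E).
  by move=> mF; apply/measurable_EFinP/measurable_normc/Cmeasurable_weighted.
have mgh : Cmeasurable (fun x => fhat g x + fhat h x) by exact: CmeasurableD.
rewrite (@ge0_ae_eq_integral _ _ _ leb setT _
  (fun x => (m x * normc (fhat g x + fhat h x))%:E))//; last 5 first.
- by apply/measurable_EFinP; exact: mN.
- by apply/measurable_EFinP; exact: mN.
- by move=> x _; rewrite lee_fin mulr_ge0// normc_ge0.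
- by move=> x _; rewrite lee_fin mulr_ge0// normc_ge0.
- by apply: filterS ae => x ->.
rewrite /= /L1norm -ge0_integralZl//; last 2 first.
- exact: mW.
- by move=> x _; rewrite lee_fin normc_ge0.
rewrite -ge0_integralD//; last 4 first.
- by move=> x _; rewrite lee_fin normc_ge0.
- exact: mW.
- by move=> x _; rewrite -EFinM lee_fin mulr_ge0// normc_ge0.
- by apply: measurable_funeM; exact: mW.
apply: ge0_le_integral => //.
- by move=> x _; rewrite lee_fin mulr_ge0// normc_ge0.
- by apply/measurable_EFinP; exact: mN.
- by apply: emeasurable_funD; [exact: mW|apply: measurable_funeM; exact: mW].
move=> x _; rewrite -EFinM -EFinD lee_fin !normc_weighted.
rewrite (@le_trans _ _ (m x * (normc (fhat g x) + normc (fhat h x))))//.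
  by rewrite ler_wpM2l// le_normcD.
by rewrite mulrDr mulrA lerD// ler_wpM2r// normc_ge0.
Qed.

Lemma ler_powRN (p x y : R) : 0 <= p -> 0 < x -> x <= y -> y `^ (- p) <= x `^ (- p).
Proof.
move=> p0 x0 xy; have y0 := lt_le_trans x0 xy.
by rewrite !powRN lef_pV2 ?posrE ?powR_gt0// ge0_ler_powR// nnegrE ltW.
Qed.

Lemma measurable_lt_set d (T : measurableType d) (u v : T -> R) :
  measurable_fun setT u -> measurable_fun setT v -> measurable [set z | u z < v z].
Proof.
move=> mu_ mv; rewrite (_ : mkset _ = setT `&` (fun z => u z < v z) @^-1` [set true]).
  exact: measurable_fun_ltr.
by rewrite setTI.
Qed.

(* Since [K rho f] dominates the integral of
   [min (jbracket ^ r) (rho * jbracket ^ t)] against [fhat f], it suffices to keep,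
   for each frequency, the scales [a < rho < 2 * a] with [a = jbracket `^ (r - t)]. *)
Lemma interp_Bspace_ge r s t theta f :
  r < s -> s < t -> theta = (s - r) / (t - r) ->
  (exists g h, [/\ nset (Bspace n r) g, nset (Bspace n t) h & g + h = f]) ->
  Cb0 f /\ is_fourier f (fhat f) /\
  ((2 `^ (- theta - 1))%:E * L1norm (weighted s (fhat f)) <=
   nnorm (interp (Bspace n r) (Bspace n t) theta) f)%E.
Proof.
move=> rs st thE [g [h [gB hB gh]]].
have [bf fF] := is_fourier_add gB hB gh; have ff := is_fourier_fhat fF.
split => //; split => //.
have tr0 : 0 < t - r by lra.
have th0 : 0 < theta by rewrite thE divr_gt0// subr_gt0.
have mF : Cmeasurable (fhat f) by apply: Cintegrable_Cmeasurable; case: ff.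
have mNF := measurable_normc mF.
(* The scale at which the two weights [<x>^r] and [rho <x>^t] coincide; above it the first is the
   smaller one. *)
pose a (x : V) := jbracket x `^ (r - t).
have a0 x : 0 < a x by rewrite powR_gt0// jbracket_gt0.
have ma : measurable_fun setT a by exact: measurable_jbracket_powR.
(* On the window [rho < 2 a], so [rho^(- theta - 1)] is at least [(2 a)^(- theta - 1)]; [q] is the
   resulting lower bound, free of [rho]. *)
pose q (x : V) := 2 `^ (- theta - 1) * (a x `^ (- theta - 1) * (jbracket x `^ r * normc (fhat f x))).
have q0 x : 0 <= q x by rewrite !mulr_ge0// ?powR_ge0// normc_ge0.
have mq : measurable_fun setT q.
  apply: measurable_funM => //; apply: measurable_funM.
    exact: (measurableT_comp (measurable_powR _) ma).
  by apply: measurable_funM => //; exact: measurable_jbracket_powR.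
pose A : set (measurableTypeR R * V) := [set z | a z.2 < z.1] `&` [set z | z.1 < 2 * a z.2].
have ma2 : measurable_fun setT (fun z : measurableTypeR R * V => a z.2).
  exact: (measurableT_comp ma measurable_snd).
have mfst : measurable_fun setT (fun z : measurableTypeR R * V => z.1 : R).
  exact: measurable_fst.
have mA : measurable A.
  apply: measurableI; apply: measurable_lt_set => //.
  by apply: measurable_funM => //; exact: measurable_cst.
pose Q (z : measurableTypeR R * V) : \bar R := (q z.2 * \1_A z)%:E.
have mQ : measurable_fun setT Q.
  apply/measurable_EFinP; apply: measurable_funM; last exact: measurable_indic.
  exact: (measurableT_comp mq measurable_snd).
have Q0 z : (0 <= Q z)%E by rewrite lee_fin mulr_ge0.
have intQ x : (\int[mu]_rho Q (rho, x) = (2 `^ (- theta - 1))%:E *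
    (normc (weighted s (fhat f) x))%:E)%E.
  transitivity (\int[mu]_rho ((q x)%:E * (\1_A (rho, x))%:E))%E.
    by apply: eq_integral => rho _; rewrite -EFinM.
  rewrite ge0_integralZl//; last 2 first.
  - have mI : measurable_fun setT (\1_A : measurableTypeR R * V -> R).
      exact: measurable_indic.
    apply/measurable_EFinP; exact: (measurableT_comp mI (measurable_pair2 x)).
  - by rewrite lee_fin.
  rewrite [X in (_ * X)%E](_ : _ =
    \int[mu]_rho (\1_(`]a x, (2 * a x)%R[%classic : set (measurableTypeR R)) rho)%:E)%E; last first.
    apply: eq_integral => rho _; rewrite !indicE; congr (_ %:R%:E); congr nat_of_bool.
    by apply/idP/idP; rewrite !inE /A /= in_itv/= => /andP.
  have muE : mu (`]a x, 2 * a x[%classic : set (measurableTypeR R)) = (a x)%:E.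
    rewrite lebesgue_measure_itv/= lte_fin; have ax := a0 x.
    by rewrite ifT; [rewrite -EFinD; congr EFin; ring|lra].
  rewrite integral_indic//= setIT [X in (_ * X)%E]muE -!EFinM; congr EFin.
  rewrite normc_weighted /q.
  (* The window has length [a], and [a^(- theta) <x>^r = <x>^(theta (t - r) + r) = <x>^s]. *)
  have key : a x `^ (- theta - 1) * jbracket x `^ r * a x = jbracket x `^ s.
    rewrite /a -powRrM -!powRD ?(gt_eqF (jbracket_gt0 _)) ?implybT//; congr (_ `^ _).
    by rewrite thE; field; lra.
  by rewrite -key; ring.
rewrite /= /L1norm -ge0_integralZl//; last 2 first.
- by apply/measurable_EFinP/measurable_normc/Cmeasurable_weighted.
- by move=> x _; rewrite lee_fin normc_ge0.
under eq_integral do rewrite -intQ.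
rewrite -(fubini_tonelli Q)//.
(* The windows lie in the positive half-line, so Tonelli over the whole line loses nothing when
   restricted to [rho > 0]. *)
have G0 rho : ~ (0 < rho) -> (\int[leb]_x Q (rho, x) = 0)%E.
  move=> rho0; apply: integral0_eq => x _; rewrite /Q indicE memNset ?mulr0//.
  by move=> [/= ar _]; apply: rho0; exact: lt_trans ar.
have mG : measurable_fun setT (fun rho => \int[leb]_x Q (rho, x))%E.
  exact: measurable_fun_fubini_tonelli_F.
rewrite [leLHS](_ : _ = \int[mu]_(rho in `]0%R, +oo[) \int[leb]_x Q (rho, x))%E; last first.
  rewrite [RHS]integral_mkcond; apply: eq_integral => rho _; rewrite patchE.
  case: ifPn => //; rewrite notin_setE /= in_itv/= andbT => rho0.
  exact: G0.
have [_ _ _ goo] := Bspace_fhat gB; have [_ _ _ hoo] := Bspace_fhat hB.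
have := @measurable_Kweight R _ (Bspace n r) (Bspace n t) (nnorm_Bspace_ge0 r)
  (nnorm_Bspace_ge0 t) theta g h gB hB goo hoo.
rewrite gh => mK; apply: ge0_le_integral => //.
- by move=> rho _; apply: integral_ge0.
- exact: measurable_funTS.
move=> rho; rewrite /= in_itv/= andbT => rho0.
pose m (x : V) : R := jbracket x `^ r * \1_A (rho, x).
have mm : measurable_fun setT m.
  apply: measurable_funM; first exact: measurable_jbracket_powR.
  have mI : measurable_fun setT (\1_A : measurableTypeR R * V -> R) by exact: measurable_indic.
  exact: (measurableT_comp mI (measurable_pair1 rho)).
have m0 x : 0 <= m x by rewrite mulr_ge0// powR_ge0.
have mNF' : measurable_fun setT (fun x => m x * normc (fhat f x)) by exact: measurable_funM.
have mr x : m x <= jbracket x `^ r.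
  by rewrite /m indicE; case: (_ \in _); rewrite ?mulr1// mulr0 powR_ge0.
have mt x : m x <= rho * jbracket x `^ t.
  rewrite /m indicE; case: (boolP (_ \in _)) => [|_]; last first.
    by rewrite mulr0 mulr_ge0 ?(ltW rho0)// powR_ge0.
  rewrite inE => -[/= ar _]; rewrite mulr1.
  rewrite (_ : _ `^ r = a x * jbracket x `^ t).
    by rewrite ler_wpM2r ?powR_ge0// ltW.
  by rewrite /a -powRD ?(gt_eqF (jbracket_gt0 _)) ?implybT// subrK.
have KI := Kfun_Bspace_ge (ltW rho0) mF mm m0 mr mt.
rewrite /Kweight muleAC -EFinM.
apply: (@le_trans _ _ ((rho `^ (- theta) * rho^-1)%:E * \int[leb]_x (m x * normc (fhat f x))%:E)%E);
  last by rewrite lee_wpmul2l// lee_fin mulr_ge0 ?powR_ge0// invr_ge0 ltW.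
rewrite -ge0_integralZl//; last 3 first.
- exact/measurable_EFinP.
- by move=> x _; rewrite lee_fin mulr_ge0// normc_ge0.
- by rewrite lee_fin mulr_ge0 ?powR_ge0// invr_ge0 ltW.
apply: ge0_le_integral => //.
- exact: (measurableT_comp mQ (measurable_pair1 rho)).
- by apply: measurable_funeM; exact/measurable_EFinP.
move=> x _; rewrite -EFinM lee_fin /m indicE.
case: (boolP (_ \in _)) => [|_]; last by rewrite !(mulr0, mul0r).
rewrite inE => -[/= ar ra]; rewrite !mulr1 /q mulrA ler_wpM2r//.
  by rewrite mulr_ge0 ?powR_ge0// normc_ge0.
rewrite -powRM//; last exact: ltW.
have -> : rho `^ (- theta) * rho^-1 = rho `^ (- (theta + 1)).
  rewrite opprD powRD; last by rewrite (gt_eqF rho0) implybT.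
  by rewrite powR_inv1// ltW.
by rewrite -opprD; apply: ler_powRN => //; [lra|exact: ltW].
Qed.

Lemma L1norm_weighted_le (s q : R) (F H : V -> R[i]) (c : R) : 0 <= c -> Cmeasurable F -> Cmeasurable H ->
  (forall x, normc (weighted q H x) <= c * normc (weighted s F x)) ->
  (L1norm (weighted q H) <= c%:E * L1norm (weighted s F))%E.
Proof.
move=> c0 mF mH HF.
have mN : measurable_fun setT (fun x => normc (weighted s F x)).
  exact/measurable_normc/Cmeasurable_weighted.
rewrite [leRHS](_ : _ = \int[leb]_x (c * normc (weighted s F x))%:E)%E.
  apply: le_L1norm => //; first exact: Cmeasurable_weighted.
  exact: measurable_funM.
rewrite /L1norm -ge0_integralZl//; first exact/measurable_EFinP.
by move=> x _; rewrite lee_fin normc_ge0.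
Qed.

(* Splitting the transform of [f] at [jbracket xi = rho `^ (- (t - r)^-1)]
   balances the two terms of the K-functional. *)
Lemma Kfun_Bspace_le r s t theta f (rho : R) :
  r < s -> s < t -> theta = (s - r) / (t - r) -> 0 < rho -> nset (Bspace n s) f ->
  (Kfun (Bspace n r) (Bspace n t) rho f <=
    (2 * rho `^ theta)%:E * nnorm (Bspace n s) f)%E.
Proof.
move=> rs st thE rho0 fB; have [bf ff mF foo] := Bspace_fhat fB.
have iF : Cintegrable (fhat f) by case: ff.
have tr0 : 0 < t - r by lra.
pose lam := rho `^ (- (t - r)^-1).
have lam0 : 0 < lam by exact: powR_gt0.
(* Low frequencies are kept: they form the component in B^t, and the high frequencies form the one
   in B^r. *)
pose chi (x : V) : R := if lam < jbracket x then 0 else 1.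
have mchi : measurable_fun setT chi.
  apply: measurable_fun_ifT; [|exact: measurable_cst|exact: measurable_cst].
  by apply: measurable_fun_ltr; [exact: measurable_cst|exact: measurable_jbracket].
pose G (x : V) := ((chi x)%:C)%C * fhat f x.
have mG : Cmeasurable G by apply: CmeasurableM => //; exact: Cmeasurable_realC.
have iG : Cintegrable G.
  apply: (@Cintegrable_bounded _ _ (fhat f) (fun x => ((chi x)%:C)%C) 1) => //.
  by move=> x; rewrite normc_realC /chi; case: ifP; rewrite ?normr0 ?normr1.
pose g (x : V) := (inv_cst n)^-1 * iFT G x.
have bg : Cb0 g by exact: Cb0_inverse.
have gG : is_fourier g G by exact: is_fourier_iFT.
pose h (x : V) := 1 * f x + (-1) * g x.
have bh : Cb0 h by exact: Cb0_lin.
pose H (x : V) := 1 * fhat f x + (-1) * G x.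
have hH : is_fourier h H by exact: is_fourier_lin.
have mH : Cmeasurable H by apply: Cintegrable_Cmeasurable; case: hH.
have j0 x := jbracket_gt0 (x : V).
have pD x (p q : R) : jbracket (x : V) `^ (p + q) = jbracket x `^ p * jbracket x `^ q.
  by rewrite powRD// (gt_eqF (j0 x)) implybT.
(* Where [H] is nonzero, [<x> > lam]; the exponent [r - s] is negative, so
   [<x>^(r - s) <= lam^(r - s)]. *)
have hN : (L1norm (weighted r H) <= (lam `^ (r - s))%:E * L1norm (weighted s (fhat f)))%E.
  apply: L1norm_weighted_le => //; first exact: powR_ge0.
  move=> x; rewrite !normc_weighted /H /G /chi; case: ifPn => [lx|_].
    rewrite mul0r mulr0 addr0 mul1r mulrA ler_wpM2r ?normc_ge0//.
    rewrite -[in leLHS](subrK s r) pD ler_wpM2r ?powR_ge0//.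
    by rewrite -opprB; apply: ler_powRN => //; [lra|exact: ltW].
  rewrite [X in normc X](_ : _ = 0); last by ring.
  rewrite ComplexField.Normc.normc0 mulr0 !mulr_ge0 ?powR_ge0// normc_ge0//.
have gN : (L1norm (weighted t G) <= (lam `^ (t - s))%:E * L1norm (weighted s (fhat f)))%E.
  apply: L1norm_weighted_le => //; first exact: powR_ge0.
  move=> x; rewrite !normc_weighted /G /chi; case: ifPn => [_|].
    rewrite mul0r ComplexField.Normc.normc0 mulr0 !mulr_ge0 ?powR_ge0// normc_ge0//.
  rewrite -leNgt => xl; rewrite mul1r mulrA ler_wpM2r ?normc_ge0//.
  rewrite -[in leLHS](subrK s t) pD ler_wpM2r ?powR_ge0//.
  by apply: ge0_ler_powR; rewrite ?nnegrE ?(ltW lam0) ?(ltW (j0 x))//; lra.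
have cfin c : (c%:E * L1norm (weighted s (fhat f)) < +oo)%E.
  have := L1norm_ge0 (weighted s (fhat f)); move: foo.
  by case: (L1norm _) => // l _ _; rewrite -EFinM ltry.
have hB : nset (Bspace n r) h by apply: (Bspace_intro bh hH); exact: le_lt_trans hN (cfin _).
have gB : nset (Bspace n t) g by apply: (Bspace_intro bg gG); exact: le_lt_trans gN (cfin _).
have fE : f = h + g.
  apply/funext => x; rewrite -[RHS]/(1 * f x + (-1) * g x + g x).
  by rewrite mul1r mulN1r subrK.
rewrite [X in Kfun _ _ _ X]fE; apply: le_trans (Kfun_le _ hB gB) _.
rewrite /= (L1norm_weighted_fhat _ hH) (L1norm_weighted_fhat _ gG).
(* With this threshold each of the two terms carries the same factor [rho^theta]; their sum explains
   the constant 2. *)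
have lamr : lam `^ (r - s) = rho `^ theta.
  by rewrite /lam -powRrM; congr (_ `^ _); rewrite thE; field; lra.
have lamt : rho * lam `^ (t - s) = rho `^ theta.
  rewrite /lam -powRrM -{1}(powRr1 (ltW rho0)) -powRD ?(gt_eqF rho0) ?implybT//.
  by congr (_ `^ _); rewrite thE; field; lra.
rewrite (_ : (2 * rho `^ theta)%:E * _ =
    (lam `^ (r - s))%:E * L1norm (weighted s (fhat f)) +
    rho%:E * ((lam `^ (t - s))%:E * L1norm (weighted s (fhat f))))%E.
  by rewrite leeD// lee_wpmul2l// lee_fin ltW.
rewrite muleA -EFinM lamt lamr -ge0_muleDl ?lee_fin ?powR_ge0// -EFinD.
by congr (_%:E * _)%E; ring.
Qed.

(** Two bounds on the K-functional compete: [2 rho^theta] times the norm from the cutoff, and the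
    norm itself from the splitting [f + 0]. Multiplied by [rho^(- theta' - 1)] they give the two
    powers in the minimum. *)
Lemma Bspace_interp_le r s t theta theta' f :
  r < s -> s < t -> theta = (s - r) / (t - r) -> 0 < theta' -> theta' < theta ->
  nset (Bspace n s) f ->
  let C := (\int[mu]_(rho in `]0%R, +oo[)
     (Num.min (rho `^ (theta - theta' - 1)) (rho `^ (- theta' - 1)))%:E)%E in
  nset (interp (Bspace n r) (Bspace n t) theta') f /\
  (nnorm (interp (Bspace n r) (Bspace n t) theta') f <=
   2%:E * C * nnorm (Bspace n s) f)%E.
Proof.
move=> rs st thE th'0 th' fB C.
have rt : r <= t by lra.
have [bf ff mF foo] := Bspace_fhat fB.
have [fr frN] := le_Bspace (ltW rs) fB.
have [zB zN] := Bspace0 t.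
pose N := nnorm (Bspace n s) f.
have N0 : (0 <= N)%E by exact: nnorm_Bspace_ge0.
have fE : f = f + (0 : V -> R[i]) by rewrite addr0.
have roo : (nnorm (Bspace n r) f < +oo)%E by exact: le_lt_trans frN foo.
have zoo : (nnorm (Bspace n t) (0 : V -> R[i]) < +oo)%E by rewrite zN ltry.
have := @measurable_Kweight R _ (Bspace n r) (Bspace n t) (nnorm_Bspace_ge0 r)
  (nnorm_Bspace_ge0 t) theta' f 0 fr zB roo zoo.
rewrite -fE => mK.
have zE (x : \bar R) (rho : R) : (x + rho%:E * nnorm (Bspace n t) (0 : V -> R[i]) = x)%E.
  by rewrite zN mule0 adde0.
have Kle rho : (Kfun (Bspace n r) (Bspace n t) rho f <= N)%E.
  have := @Kfun_le R _ (Bspace n r) (Bspace n t) rho f 0 fr zB.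
  by rewrite zE -fE => K_le; exact: le_trans K_le frN.
have mp q : measurable_fun setT (fun r : R => r `^ q) by exact: measurable_powR.
pose M (rho : R) := Num.min (rho `^ (theta - theta' - 1)) (rho `^ (- theta' - 1)).
have M0 rho : 0 <= M rho by rewrite le_min !powR_ge0.
have mM : measurable_fun setT (EFin \o M) by apply/measurable_EFinP; exact: measurable_minr.
have KM rho : 0 < rho ->
    (Kweight (Bspace n r) (Bspace n t) theta' f rho <= (2 * M rho)%:E * N)%E.
  move=> rho0; have rn : rho != 0 by rewrite gt_eqF.
  have w0 : 0 <= rho `^ (- theta') * rho^-1 by rewrite mulr_ge0 ?powR_ge0// invr_ge0 ltW.
  have wE : rho `^ (- theta') * rho^-1 = rho `^ (- theta' - 1).
    by rewrite [RHS]powRD ?rn ?implybT// powR_inv1// ltW.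
  rewrite /Kweight muleAC -EFinM.
  have [le|le] := leP (rho `^ (theta - theta' - 1)) (rho `^ (- theta' - 1)).
    rewrite /M (min_idPl le).
    apply: le_trans (lee_wpmul2l _ (Kfun_Bspace_le rs st thE rho0 fB)) _; first by rewrite lee_fin.
    rewrite muleA -EFinM lee_wpmul2r// lee_fin wE mulrCA -powRD ?rn ?implybT//.
    by rewrite (_ : - theta' - 1 + theta = theta - theta' - 1)//; ring.
  rewrite /M (min_idPr (ltW le)) wE.
  apply: le_trans (lee_wpmul2l _ (Kle rho)) _; first by rewrite lee_fin powR_ge0.
  rewrite [in leRHS]EFinM -muleA.
  have x0 : (0 <= (rho `^ (- theta' - 1))%:E * N)%E by rewrite mule_ge0// lee_fin powR_ge0.
  by rewrite -[leLHS]mul1e lee_wpmul2r// lee_fin; lra.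
have K0 rho : 0 < rho -> (0 <= Kweight (Bspace n r) (Bspace n t) theta' f rho)%E.
  by move=> rho0; exact: (Kweight_ge0 (nnorm_Bspace_ge0 r) (nnorm_Bspace_ge0 t) _ _ rho0).
have mM2 : measurable_fun setT (fun rho : measurableTypeR R => (2 * M rho)%:E * N)%E.
  rewrite (_ : (fun _ => _) = (fun rho => (2%:E * N) * (M rho)%:E)%E).
    by apply: emeasurable_funM => //; exact: measurable_cst.
  by apply/funext => rho; rewrite EFinM muleAC.
have le : (nnorm (interp (Bspace n r) (Bspace n t) theta') f <= 2%:E * C * N)%E.
  rewrite /= (_ : 2%:E * C * N = \int[mu]_(rho in `]0%R, +oo[) ((2 * M rho)%:E * N))%E.
    apply: ge0_le_integral => //.
    - by move=> rho; rewrite /= in_itv/= andbT; exact: K0.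
    - exact: measurable_funTS.
    - by move=> rho; rewrite /= in_itv/= andbT; exact: KM.
  rewrite ge0_integralZr//; last 2 first.
  - by apply/measurable_funTS/measurable_EFinP/measurable_funM => //; exact/measurable_EFinP.
  - by move=> rho _; rewrite lee_fin mulr_ge0.
  congr (_ * _)%E; under [RHS]eq_integral do rewrite EFinM.
  rewrite ge0_integralZl//; first exact: measurable_funTS.
  by move=> rho _; rewrite lee_fin.
split => //; split; first by exists f, 0.
apply/integrableP; split => //.
have absE : (\int[mu]_(rho in `]0%R, +oo[)
    `|Kweight (Bspace n r) (Bspace n t) theta' f rho| =
    nnorm (interp (Bspace n r) (Bspace n t) theta') f)%E.
  apply: eq_integral => rho; rewrite inE/= in_itv/= andbT => rho0.
  by rewrite gee0_abs// K0.
rewrite [ltLHS]absE.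
apply: le_lt_trans le _.
have a0 : 0 < theta - theta' by rewrite subr_gt0.
have Coo := integral_powR_min_lty a0 th'0.
have C0 : (0 <= C)%E by apply: integral_ge0 => rho _; rewrite lee_fin M0.
have Cf : C \is a fin_num by rewrite ge0_fin_numE.
have Nf : N \is a fin_num by rewrite (ge0_fin_numE N0); exact: foo.
have fin_lty (x y : \bar R) : x \is a fin_num -> y \is a fin_num -> (2%:E * x * y < +oo)%E.
  by move=> /fineK <- /fineK <-; rewrite -!EFinM ltry.
exact: fin_lty.
Qed.

End Bspace_interpolation.

(** [embeds] asks for continuity at every point, on sets not assumed closed under subtraction, so
    the bound is required on differences of members; then [e / C] is the modulus. *)
Lemma embeds_bounded (R : realType) (E : zmodType) (Y X : @nspace R E) (C : R) :
  0 < C -> nset Y `<=` nset X ->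
  (forall f g, nset Y f -> nset Y g -> (nnorm X (g - f)%R <= C%:E * nnorm Y (g - f)%R)%E) ->
  embeds Y X.
Proof.
move=> C0 YX H; split => // f fY e e0; exists (e / C); first by rewrite divr_gt0.
move=> g gY ge; apply: le_lt_trans (H _ _ fY gY) _.
by rewrite -lte_pdivlMl// muleC.
Qed.

Theorem theorem2p2 (R : realType) (n : nat) (r s t theta theta' : R) :
  (0 < n)%N -> 0 <= r -> r < s -> s < t ->
  theta = (s - r) / (t - r) -> 0 < theta' -> theta' < theta ->
  embeds (interp (Bspace n r) (Bspace n t) theta) (Bspace n s) /\
  embeds (Bspace n s) (interp (Bspace n r) (Bspace n t) theta').
Proof.
move=> _ _ rs st thE th'0 th'; split.
  have c0 : 0 < 2 `^ (- theta - 1) :> R by exact: powR_gt0.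
  have norm_le f := @interp_Bspace_ge R n r s t theta f rs st thE.
  have norm_le' f : (exists g h, [/\ nset (Bspace n r) g, nset (Bspace n t) h & g + h = f]) ->
      (nnorm (Bspace n s) f <= ((2 `^ (- theta - 1))^-1)%:E *
        nnorm (interp (Bspace n r) (Bspace n t) theta) f)%E.
    by move=> /norm_le[_ [_]]; rewrite lee_pdivlMl.
  apply: (@embeds_bounded _ _ _ _ (2 `^ (- theta - 1))^-1); first by rewrite invr_gt0.
  - move=> f [fd fi]; have [bf [ff le]] := norm_le _ fd.
    apply: (Bspace_intro bf ff); apply: le_lt_trans (norm_le' _ fd) _.
    rewrite lte_mul_pinfty// ?lee_fin ?invr_ge0 ?(ltW c0)//.
    by apply: integrable_lty fi; exact: measurable_itv.
  (* Splittings of the two functions subtract to a splitting of their difference. *)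
  - move=> f g [[f0 [f1 [f0r f1t <-]]] _] [[g0 [g1 [g0r g1t <-]]] _].
    apply: norm_le'; exists (g0 - f0), (g1 - f1); split; try exact: BspaceB.
    by rewrite opprD addrACA.
have C := @integral_powR_min_lty R (theta - theta') theta' _ th'0.
have {}C := C (ltac:(by rewrite subr_gt0)).
have norm_le f := @Bspace_interp_le R n r s t theta theta' f rs st thE th'0 th'.
pose C' := fine (\int[lebesgue_measure]_(rho in `]0%R, +oo[)
     (Num.min (rho `^ (theta - theta' - 1)) (rho `^ (- theta' - 1)))%:E)%E.
have C0 : (0 <= \int[lebesgue_measure]_(rho in `]0%R, +oo[)
     (Num.min (rho `^ (theta - theta' - 1)) (rho `^ (- theta' - 1)))%:E)%E.
  by apply: integral_ge0 => x _; rewrite lee_fin le_min !powR_ge0.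
have C'0 : 0 <= C' by exact: fine_ge0.
(* Adding 1 turns the nonnegativity of [C'] into a positive constant. *)
apply: (@embeds_bounded _ _ _ _ (2 * C' + 1)).
- by rewrite ltr_wpDl// mulr_ge0.
- by move=> f /norm_le[].
- move=> f g fs gs; have [_ le] := norm_le _ (BspaceB gs fs).
  apply: le_trans le _; rewrite lee_wpmul2r ?nnorm_Bspace_ge0//.
  rewrite (_ : (2%:E * _)%E = (2 * C')%:E); first by rewrite lee_fin lerDl.
  by rewrite EFinM fineK// ge0_fin_numE.
Qed.
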